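(* Let $N$ be an $n$-dimensional Riemannian manifold, let $f\colon\mathbb{R}\to\mathbb{R}_{>0}$ be a smooth logarithmically convex function with $f(0)=1$, and let $W=\mathbb{R}\times_f N$ be the associated warped product of dimension $1+n$, assumed complete. Consider rooms $R$ over piecewise smooth $n$-dimensional floors $F\subseteq\{0\}\times N$ of finite $n$-volume whose ceilings $C$ are graphs over $F$ of almost everywhere differentiable functions and such that the $\mathbb{R}$-coordinate of every point of $C$ is nonnegative. Then the $(1+n)$-volume of $R$ can be bounded from above by a function of the $n$-volume of $C$ (that is, there is a function $\Phi\colon[0,\infty)\to[0,\infty)$ with $\mathrm{Vol}_{1+n}(R)\le\Phi(\mathrm{Vol}_n(C))$ for all such rooms with $\mathrm{Vol}_n(C)<\infty$) if and only if $f$ is unbounded on $[0,\infty)$. In this case, every such room satisfies $$\mathrm{Vol}_{1+n}(R)\le \frac{\mathrm{Vol}_n(C)}{\omega},$$ where $\omega>0$ is equal to the critical value corresponding to the smallest positive critical point of the function $$\mathcal{I}(h)=\frac{d}{dh}\log\left(\int_0^h f(t)^n\,dt\right),\qquad h>0,$$ if $\mathcal{I}$ has a positive critical point, and $\omega=\lim_{h\to\infty} n f'(h)/f(h)$ if $\mathcal{I}$ has no positive critical points.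
   Context: Warped product: given a smooth function $f\colon\mathbb{R}\to\mathbb{R}_{>0}$ and a Riemannian manifold $N$, let $\pi\colon\mathbb{R}\times N\to\mathbb{R}$ and $\eta\colon\mathbb{R}\times N\to N$ be the projections. The warped product $W=\mathbb{R}\times_f N$ is the product manifold $\mathbb{R}\times N$ with the Riemannian metric satisfying $\|v\|_W^2=\|\pi_*(v)\|_{\mathbb{R}}^2+f(\pi(p))^2\|\eta_*(v)\|_N^2$ for all $v\in T_pW$. The function $f$ is logarithmically convex if $\log f$ is convex (not necessarily strictly). The set $\{0\}\times N$ is a vertical fiber. Graphs and rooms: for $F\subseteq\{0\}\times N$ (the floor) and $g\colon\eta(F)\to[0,\infty)$ (possibly discontinuous, differentiable almost everywhere), the graph of $g$ over $F$ (the ceiling) is $C=\{(g(q),q):(0,q)\in F\}\subset W$, and the room over $F$ enclosed by $C$ is $R=\{(t,q):(0,q)\in F,\ 0\le t\le g(q)\}\subset W$. $\mathrm{Vol}_k(\cdot)$ denotes $k$-dimensional volume with respect to the metric of $W$.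
   Formalization: The equivalence is proved assuming no constant bounds all room volumes (for N a circle and f(t)=e^{-t} its ''only if'' half fails, as a constant Φ works), and n ≥ 1 is assumed (for n = 0 one gets ω = 0); the bound by Vol(C)/ω needs only n ≥ 1. *)

(* Defs.v *)
From HB Require Import structures.
From mathcomp Require Import all_boot all_order all_algebra.
From mathcomp Require Import all_classical all_reals all_analysis.

Set Implicit Arguments.
Unset Strict Implicit.
Unset Printing Implicit Defensive.

Import Order.TTheory GRing.Theory Num.Theory.
Import numFieldNormedType.Exports.

Local Open Scope classical_set_scope.
Local Open Scope ring_scope.

(** The n-fold product of Lebesgue measure, on the product sigma-algebra of
    [n.-tuple R], is obtained by transporting [lebesgue \x lebesgue^n] along
    [(t, x) |-> t :: x]. *)

Section lebesgue_tuple.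
Variable R : realType.
Local Notation mR := (measurableTypeR R).

Definition tuple_cons n (p : mR * n.-tuple mR) : n.+1.-tuple mR :=
  [tuple of p.1 :: p.2].

Lemma measurable_tuple_cons n : measurable_fun [set: _] (@tuple_cons n).
Proof. by apply: measurable_cons. Qed.

Section step.
Variables (n : nat) (m : {sigma_finite_measure set (n.-tuple mR) -> \bar R}).

Definition lebesgue_cons : set (n.+1.-tuple mR) -> \bar R :=
  pushforward (@lebesgue_measure R \x m)%E (@tuple_cons n).

Let lebesgue_cons0 : lebesgue_cons set0 = 0%E.
Proof. by rewrite /lebesgue_cons /pushforward preimage_set0 measure0. Qed.

Let lebesgue_cons_ge0 A : (0 <= lebesgue_cons A)%E.
Proof. exact: (@measure_ge0 _ _ _ (@lebesgue_measure R \x m)%E). Qed.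

Let lebesgue_cons_additive : semi_sigma_additive lebesgue_cons.
Proof.
move=> F mF tF mUF; rewrite /lebesgue_cons /pushforward preimage_bigcup.
have mc A : measurable A -> measurable (@tuple_cons n @^-1` A).
  by move=> mA; rewrite -[X in measurable X]setTI; exact: measurable_tuple_cons.
apply: measure_semi_sigma_additive => [i||]; first exact: mc.
- apply/trivIsetP => /= i j _ _ ij; rewrite -preimage_setI.
  by move/trivIsetP : tF => /(_ _ _ _ _ ij) ->//; rewrite preimage_set0.
- by rewrite -preimage_bigcup; exact: mc.
Qed.

HB.instance Definition _ := isMeasure.Build _ _ _ lebesgue_cons
  lebesgue_cons0 lebesgue_cons_ge0 lebesgue_cons_additive.

Let lebesgue_cons_sigma_finite : sigma_finite setT lebesgue_cons.
Proof.
have [F TF Foo] : sigma_finite setT (@lebesgue_measure R \x m)%E.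
  have /sigma_finiteP[F [TF ndF Foo]] := sigma_finiteT (@lebesgue_measure R).
  have /sigma_finiteP[G [TG ndG Goo]] := sigma_finiteT m.
  exists (fun k => F k `*` G k).
    rewrite -setXTT TF TG predeqE => -[x y]; split.
      move=> [/= [i _ Fi] [j _ Gj]]; exists (maxn i j) => //; split.
      - by move: x Fi; exact/subsetPset/ndF/leq_maxl.
      - by move: y Gj; exact/subsetPset/ndG/leq_maxr.
    by move=> [i _ []/= ? ?]; split; exists i.
  move=> k; have [? ?] := Foo k; have [? ?] := Goo k.
  split; first exact: measurableX.
  by rewrite product_measure1E// lte_mul_pinfty// ge0_fin_numE.
pose u (x : n.+1.-tuple mR) : mR * n.-tuple mR := (thead x, [tuple of behead x]).
have uK p : u (tuple_cons p) = p.
  by case: p => t x; rewrite /u theadE; congr pair; exact: val_inj.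
have Ku x : tuple_cons (u x) = x by rewrite [RHS]tuple_eta; exact: val_inj.
have mu : measurable_fun setT u.
  apply/measurable_fun_pairP; split; last exact: measurable_behead.
  rewrite (_ : fst \o u = (fun x => tnth x ord0))//.
  exact: measurable_tnth.
exists (fun k => u @^-1` F k).
  by rewrite -preimage_bigcup -TF preimage_setT.
move=> k; have [mF Fk] := Foo k; split; first by rewrite -[X in measurable X]setTI; exact: mu.
rewrite /lebesgue_cons /pushforward -comp_preimage.
by rewrite (_ : u \o _ = id) //; apply/funext => p /=.
Qed.

HB.instance Definition _ :=
  Measure_isSigmaFinite.Build _ _ _ lebesgue_cons lebesgue_cons_sigma_finite.

End step.

Fixpoint lebesgue_tuple n : {sigma_finite_measure set (n.-tuple mR) -> \bar R} :=
  match n with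
  | 0 => \d_([tuple] : 0.-tuple mR)
  | n'.+1 => lebesgue_cons (lebesgue_tuple n')
  end.

End lebesgue_tuple.

Definition row_of_tuple (R : realType) n (x : n.-tuple (measurableTypeR R)) :
  'rV[R]_n := \row_(i < n) (tnth x i : R).

(** For nonnegative [h] the integral is the supremum of the integrals of the
    Borel simple functions below [h] on [D]; it agrees with the integral for
    the completed measure when [D] and [h] are only Lebesgue measurable. *)
Definition rV_integral (R : realType) n (D : set 'rV[R]_n) (h : 'rV[R]_n -> R)
    : \bar R :=
  (\int[lebesgue_tuple R n]_(x in (@row_of_tuple R n) @^-1` D)
     (h (row_of_tuple x))%:E)%E.

Definition rV_negligible (R : realType) n (D : set 'rV[R]_n) : Prop :=
  (lebesgue_tuple R n).-negligible ((@row_of_tuple R n) @^-1` D).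

Fixpoint Ck_on (R : realType) (V W : normedModType R) (k : nat)
    (U : set V) (h : V -> W) : Prop :=
  match k with
  | 0 => forall x, U x -> {for x, continuous h}
  | k'.+1 => (forall x, U x -> differentiable h x) /\
             (forall v, Ck_on k' U (fun x => 'D_v h x))
  end.

Definition smooth_on (R : realType) (V W : normedModType R)
  (U : set V) (h : V -> W) : Prop := forall k, Ck_on k U h.

(** The raw data is a topological space with a countable atlas: chart [k] is
    the homeomorphism [coord k] from [dom k] to an open subset of R^n, with
    inverse [param k], and [gram k x] is the Gram matrix of the metric in the
    coordinate basis at the point of coordinates [x].  Any second countable
    manifold has such an atlas (charts may be repeated or have empty domain). *)

Record riem_data (R : realType) (n : nat) := RiemData {
  points :> topologicalType;
  dom : nat -> set points;
  coord : nat -> points -> 'rV[R]_n;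
  param : nat -> 'rV[R]_n -> points;
  gram : nat -> 'rV[R]_n -> 'M[R]_n
}.

Arguments dom {R n} M k : rename.
Arguments coord {R n} M k p : rename.
Arguments param {R n} M k x : rename.
Arguments gram {R n} M k x : rename.

Section riemannian.
Variables (R : realType) (n : nat) (M : riem_data R n).
Local Notation dom := (dom M).
Local Notation coord := (coord M).
Local Notation param := (param M).
Local Notation gram := (gram M).

Definition cdom (k : nat) : set 'rV[R]_n := coord k @` dom k.

Definition sqnorm (k : nat) (x v : 'rV[R]_n) : R :=
  (v *m gram k x *m v^T) 0 0.

(** Second countability is not listed: it follows from the countable atlas.
    [jacobian] acts on row vectors from the right, whence the last clause. *)
Record is_riemannian : Prop := IsRiemannian {
  riem_hausdorff : hausdorff_space M;
  riem_cover : forall p : M, exists k, dom k p;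
  riem_dom_open : forall k, open (dom k);
  riem_cdom_open : forall k, open (cdom k);
  riem_coordK : forall k p, dom k p -> param k (coord k p) = p;
  riem_coord_cont : forall k p, dom k p -> {for p, continuous (coord k)};
  riem_param_cont : forall k x, cdom k x -> {for x, continuous (param k)};
  riem_transition : forall k l,
    smooth_on (coord k @` (dom k `&` dom l)) (coord l \o param k);
  riem_gram_smooth : forall k, smooth_on (cdom k) (gram k);
  riem_gram_sym : forall k x, cdom k x -> (gram k x)^T = gram k x;
  riem_gram_pos : forall k x v, cdom k x -> v != 0 -> 0 < sqnorm k x v;
  riem_gram_transition : forall k l x, (coord k @` (dom k `&` dom l)) x ->
    gram k x = jacobian (coord l \o param k) x
               *m gram l (coord l (param k x))
               *m (jacobian (coord l \o param k) x)^T
}.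

(** [chain_length p q s]: [p] is joined to [q] by a concatenation of C^1 curves,
    each contained in one chart domain, of total length [s].  By the Lebesgue
    number lemma every piecewise C^1 curve can be cut up in this way. *)
Inductive chain_length : M -> M -> R -> Prop :=
| chain_nil p : chain_length p p 0
| chain_cons (k : nat) (c : R -> 'rV[R]_n) (q : M) (s : R) :
    (forall t, derivable c t 1) -> continuous (derive1 c) ->
    (forall t, 0 <= t <= 1 -> cdom k (c t)) ->
    chain_length (param k (c 1)) q s ->
    chain_length (param k (c 0)) q
      ((\int[@lebesgue_measure R]_(t in `[0, 1])
          Num.sqrt (sqnorm k (c t) (derive1 c t))) + s).

Definition riem_dist (p q : M) : \bar R :=
  ereal_inf [set s%:E | s in chain_length p q].

Definition riem_complete : Prop :=
  forall u : nat -> M,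
    (forall e : R, 0 < e -> exists N0 : nat, forall i j : nat,
       (N0 <= i)%N -> (N0 <= j)%N -> (riem_dist (u i) (u j) < e%:E)%E) ->
    exists p : M, forall e : R, 0 < e -> exists N0 : nat, forall i : nat,
       (N0 <= i)%N -> (riem_dist (u i) p < e%:E)%E.

(** Riemannian volume is computed chart by chart along the partition [fdom];
    by change of variables the result does not depend on the atlas. *)
Definition fdom (k : nat) : set M :=
  [set p | dom k p /\ forall l, (l < k)%N -> ~ dom l p].

Definition first_chart (p : M) : nat := xget 0%N [set k | fdom k p].

Definition volume (A : set M) : \bar R :=
  (\sum_(0 <= k <oo)
     rV_integral (coord k @` (A `&` fdom k)) (fun x => Num.sqrt (\det (gram k x))))%E.

Definition null_set (A : set M) : Prop :=
  forall k, rV_negligible (coord k @` (A `&` dom k)).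

Definition differentiable_at (g : M -> R) (p : M) : Prop :=
  forall k, dom k p -> differentiable (g \o param k) (coord k p).

Definition ae_differentiable (F : set M) (g : M -> R) : Prop :=
  null_set [set p | F p /\ ~ differentiable_at g p].

(** [F] is an n-dimensional region with piecewise smooth boundary: near each
    of its points the frontier lies in finitely many embedded smooth
    hypersurfaces [rho i = 0], [d (rho i) <> 0]. *)
Definition piecewise_smooth (F : set M) : Prop :=
  F `<=` closure F^° /\
  forall p, (closure F `\` F^°) p ->
    exists (k : nat) (U : set 'rV[R]_n) (m : nat) (rho : 'I_m -> 'rV[R]_n -> R),
      [/\ dom k p, open U, U (coord k p), U `<=` cdom k &
        (forall i, smooth_on U (rho i)) /\
        (forall i x, U x -> rho i x = 0 -> exists v, 'D_v (rho i) x != 0) /\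
        (forall x, U x -> (closure F `\` F^°) (param k x) ->
           exists i, rho i x = 0)].

End riemannian.

(** The metric induced on the manifold [M] by a map [u] into [W], that is
    [jacobian *m gram *m jacobian^T] in coordinates. *)
Definition induced (R : realType) (n m : nat) (M : riem_data R n)
    (W : riem_data R m) (u : M -> W) : riem_data R n :=
  {| points := M; dom := dom M; coord := coord M; param := param M;
     gram := fun k x =>
       let p := u (param M k x) in
       let l := first_chart p in
       let J := jacobian (coord W l \o u \o param M k) x in
       J *m gram W l (coord W l p) *m J^T |}.

(** n-volume in [W] of [u @` A], for [u] injective on the subset [A] of an
    n-dimensional manifold and differentiable almost everywhere on [A], by the
    area formula.  The metric of [M] plays no role. *)
Definition image_volume (R : realType) (n m : nat) (M : riem_data R n)
    (W : riem_data R m) (u : M -> W) (A : set M) : \bar R :=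
  volume (M := induced u) A.

Section warped.
Variables (R : realType) (n : nat) (f : R -> R) (N : riem_data R n).

Definition warped : riem_data R (1 + n) :=
  {| points := (R * N)%type;
     dom := fun k => [set p | dom N k p.2];
     coord := fun k p => row_mx p.1%:M (coord N k p.2);
     param := fun k x => (x 0 0, param N k (rsubmx x));
     gram := fun k x =>
       block_mx 1%:M 0 0 (f (x 0 0) ^+ 2 *: gram N k (rsubmx x)) |}.

Lemma sqnorm_warped k (x : 'rV[R]_(1 + n)) (a : R) (v : 'rV[R]_n) :
  sqnorm warped k x (row_mx a%:M v) =
  a ^+ 2 + f (x 0 0) ^+ 2 * sqnorm N k (rsubmx x) v.
Proof.
rewrite /sqnorm /= mul_row_block !mulmx0 addr0 add0r mulmx1 -scalemxAr.
rewrite tr_row_mx mul_row_col -scalemxAl tr_scalar_mx -scalar_mxM.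
by rewrite !mxE eqxx mulr1n -expr2.
Qed.

(** The floor is [{0} x F]. *)
Definition fiber_map (q : N) : warped := (0, q).

Definition graph_map (g : N -> R) (q : N) : warped := (g q, q).

Definition room (F : set N) (g : N -> R) : set warped :=
  [set p | F p.2 /\ 0 <= p.1 <= g p.2].

Definition floor_volume (F : set N) : \bar R := image_volume fiber_map F.

Definition ceiling_volume (F : set N) (g : N -> R) : \bar R :=
  image_volume (graph_map g) F.

Definition room_volume (F : set N) (g : N -> R) : \bar R := volume (room F g).

(** [g] is a total function of which only the values on [F] matter. *)
Definition is_room (F : set N) (g : N -> R) : Prop :=
  [/\ piecewise_smooth F, (floor_volume F < +oo)%E,
      ae_differentiable F g & forall q, F q -> 0 <= g q].

End warped.

Section constant.
Variables (R : realType) (n : nat) (f : R -> R).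

Definition log_convex : Prop := convex_function [set: R] (fun t => ln (f t)).

Definition unbounded_right : Prop := forall K : R, exists2 t, 0 <= t & K < f t.

Definition Ifun : R -> R :=
  derive1 (fun h => ln (\int[@lebesgue_measure R]_(t in `[0, h]) (f t ^+ n))).

(** [Ifun 0] and the values at negative [h] are meaningless and not used. *)
Definition Icrit (h : R) : Prop := 0 < h /\ is_derive h 1 Ifun 0.

Definition is_omega (omega : R) : Prop :=
  (exists h, [/\ Icrit h, forall h', Icrit h' -> h <= h' & omega = Ifun h]) \/
  ((forall h, ~ Icrit h) /\
   n%:R * derive1 f h / f h @[h --> +oo] --> omega).

End constant.

Definition ceiling_controls_volume (R : realType) (n : nat) (f : R -> R)
    (N : riem_data R n) : Prop :=
  exists Phi : R -> R, (forall c, 0 <= c -> 0 <= Phi c) /\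
    forall (F : set N) (g : N -> R), is_room f F g ->
      (ceiling_volume f F g < +oo)%E ->
      (room_volume f F g <= (Phi (fine (ceiling_volume f F g)))%:E)%E.

(** No constant bounds the volumes of all rooms; equivalently, the half space
    [0, +oo[ x N of the warped product has infinite volume. *)
Definition room_volumes_unbounded (R : realType) (n : nat) (f : R -> R)
    (N : riem_data R n) : Prop :=
  forall K : R, exists (F : set N) (g : N -> R),
    is_room f F g /\ (K%:E < room_volume f F g)%E.

(* Main.v *)
(* Write v = f^n, M(h) for the integral of v over [0, h], and u = n f'/f, which
   is nondecreasing by log-convexity.  In a chart of N with Gram matrix G, the
   Gram matrix of the graph of g is f(g)^2 G + (grad g)(grad g)^T, whose
   determinant is at least that of f(g)^2 G, whereas the part of the room above
   a point has volume M(g) sqrt(det G).  So Vol(R) <= Vol(C)/omega follows, by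
   slicing, from omega M <= v on [0, +oo[.

   Now (v - c M)' = v (u - c), and I = v/M has a critical point at h exactly
   when u M = v at h.  If h0 is a critical point then omega = I(h0) = u(h0),
   so v - omega M decreases before h0, increases after it, and vanishes at h0.
   If there is none then u M < v everywhere, which forces u <= v(h)/M(h) for
   every h > 0; hence u converges to omega = sup u, and omega M <= v.

   Conversely, if f is bounded on [0, +oo[ then it is nonincreasing.  As the
   bound Phi is arbitrary, one needs rooms of unbounded volume whose ceilings
   have exactly the same volume.  If M is bounded, there are floors F of
   arbitrarily large volume, and one takes the constant height h such that
   v(h) Vol(F) = 1.  If M is unbounded, one takes a step function on a floor
   with two open pieces: the height of the first piece tends to infinity, and
   that of the second is adjusted to keep the volume of the ceiling constant. *)

Require Import Defs.
From mathcomp Require Import all_boot all_order all_algebra.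
From mathcomp Require Import all_classical all_reals all_analysis.
From mathcomp Require Import measurable_realfun ring lra.
Import Order.TTheory GRing.Theory Num.Theory numFieldNormedType.Exports.
Local Open Scope classical_set_scope.
Local Open Scope ring_scope.
(* Otherwise [coord] is the one of vector.v. *)
Import Defs.

Set Implicit Arguments.
Unset Strict Implicit.
Unset Printing Implicit Defensive.

(** * The one-variable problem *)

(** The right difference quotients at [x] are at most [s] for small increments, hence so is their
    limit. *)
Lemma derive_le_slope (R : realType) (g : R -> R) (x a s d : R) :
  is_derive x 1 g a -> 0 < d ->
  (forall h, 0 < h -> h < d -> g (x + h) <= g x + s * h) -> a <= s.
Proof.
move=> [dg <-] d0 gs.
apply: (cvgr_to_le (cvg_dnbhs_at_right dg)).
near=> h.
have h0 : 0 < h by near: h; exact: nbhs_right_gt.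
have hd : h < d by near: h; exact: nbhs_right_lt.
rewrite /= -[_ *: _]/(_ * _) ler_pdivrMl// mulrC lerBlDl -[h *: 1]/(h * 1) mulr1.
by rewrite [h + x]addrC; apply: gs.
Unshelve. all: by end_near. Qed.

Lemma derive_ge_slope (R : realType) (g : R -> R) (x a s d : R) :
  is_derive x 1 g a -> 0 < d ->
  (forall h, 0 < h -> h < d -> g (x - h) <= g x - s * h) -> s <= a.
Proof.
move=> dg d0 gs; rewrite -lerN2.
apply: (@derive_le_slope _ (fun t => g (- t)) (- x) _ _ d) => //.
  have dN : is_derive (- x) 1 (fun t : R => - t) (- 1) by apply: is_deriveN.
  have dg' : is_derive (- - x) 1 g a by rewrite opprK.
  by have := is_derive1_comp dg' dN; rewrite mulrN1.
by move=> h h0 hd; rewrite opprD opprK mulNr; exact: gs.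
Qed.

Lemma convex_le_chord (R : realType) (g : R -> R) (x y z : R) :
  convex_function [set: R] g -> x < y -> x <= z <= y ->
  g z <= g x + (g y - g x) / (y - x) * (z - x).
Proof.
move=> cg xy /andP[xz zy].
have yx : 0 < y - x by rewrite subr_gt0.
have t0 : 0 <= (y - z) / (y - x) by rewrite divr_ge0 ?subr_ge0// ltW.
have t1 : (y - z) / (y - x) <= 1 by rewrite ler_pdivrMr// mul1r lerB.
pose t := (y - z) / (y - x).
have H : g (t * x + (1 - t) * y) <= t * g x + (1 - t) * g y.
  by apply: (cg (Itv01 t0 t1) x y); rewrite inE.
have e : t * x + (1 - t) * y = z by rewrite /t; field; rewrite gt_eqF.
rewrite -[X in g X <= _]e (le_trans H)// le_eqVlt; apply/orP; left; apply/eqP.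
by rewrite /t; field; rewrite gt_eqF.
Qed.

(** Both derivatives are compared with the slope of the chord joining the points of abscissas [x]
    and [y]. *)
Lemma convex_derive_homo (R : realType) (g dg : R -> R) :
  convex_function [set: R] g -> (forall x : R, is_derive x 1 g (dg x)) ->
  {homo dg : x y / x <= y}.
Proof.
move=> cg gdg x y; rewrite le_eqVlt => /predU1P[->//|xy].
have yx : 0 < y - x by rewrite subr_gt0.
pose s := (g y - g x) / (y - x).
apply: (@le_trans _ _ s).
  apply: (derive_le_slope (gdg x) yx) => h h0 hd.
  have /(convex_le_chord cg xy) : x <= x + h <= y.
    by rewrite lerDl ltW//= -lerBrDl ltW.
  by rewrite [x + h - x]addrAC subrr add0r.
apply: (derive_ge_slope (gdg y) yx) => h h0 hd.
have /(convex_le_chord cg xy) H : x <= y - h <= y.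
  by rewrite gerBl (ltW h0) andbT lerBrDr -lerBrDl ltW.
rewrite (le_trans H)// le_eqVlt; apply/orP; left; apply/eqP.
by rewrite /s; field; rewrite gt_eqF.
Qed.

Section profile.
Variables (R : realType) (n : nat) (f : R -> R).
Hypotheses (f_smooth : smooth_on [set: R] f) (f_pos : forall t, 0 < f t).
Hypotheses (f_logconvex : log_convex f) (f_0 : f 0 = 1).

(** The logarithmic derivative of [f ^+ n], the density of the warped product along a line
    orthogonal to the fibers. *)
Definition log_slope (t : R) : R := n%:R * derive1 f t / f t.

Definition mass (h : R) : R :=
  \int[@lebesgue_measure R]_(t in `[0, h]) (f t ^+ n).

Let u := log_slope.
Let v (t : R) : R := f t ^+ n.

Lemma warp_derive (x : R) : is_derive x 1 f (derive1 f x).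
Proof.
have [df _] := f_smooth 1%N.
by rewrite derive1E; apply/derivableP/derivable1_diffP/df.
Qed.

Lemma warp_derive1_continuous : continuous (derive1 f).
Proof.
have [_ cf] := f_smooth 1%N; move=> x.
rewrite (_ : derive1 f = (fun x => 'D_1 f x)); last by apply/funext => y; rewrite derive1E.
exact: cf.
Qed.

Lemma warp_continuous : continuous f.
Proof.
by move=> x; apply/differentiable_continuous/derivable1_diffP; case: (warp_derive x).
Qed.

Lemma pow_gt0 t : 0 < v t.
Proof. by rewrite exprn_gt0. Qed.

Lemma pow_derive (t : R) : is_derive t 1 v (u t * v t).
Proof.
have df := warp_derive t.
have -> : u t * v t = (n%:R * f t ^+ n.-1) *: derive1 f t.
  have ft : f t != 0 by rewrite gt_eqF.
  rewrite -[_ *: _]/(_ * _) /u /log_slope /v.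
  (* The predecessor is truncated at [n = 0], where both sides vanish. *)
  case: n => [|m]; first by rewrite !mul0r.
  by rewrite exprS -pred_Sn; field.
have -> : v = f ^+ n by apply/funext => s; rewrite exprfctE.
exact: is_deriveX.
Qed.

Lemma pow_continuous : continuous v.
Proof.
by move=> x; apply/differentiable_continuous/derivable1_diffP; case: (pow_derive x).
Qed.

Lemma log_slope_continuous : continuous u.
Proof.
move=> x; apply: cvgM; first by apply: cvgM; [exact: cvg_cst|exact: warp_derive1_continuous].
by apply: cvgV; [rewrite gt_eqF|exact: warp_continuous].
Qed.

Lemma ln_warp_derive (t : R) :
  is_derive t 1 (fun t => ln (f t)) (derive1 f t / f t).
Proof.
by rewrite mulrC; apply: (is_derive1_comp (is_derive1_ln (f_pos t)) (warp_derive t)).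
Qed.

Lemma ln_warp_slope_homo : {homo (fun t => derive1 f t / f t) : x y / x <= y}.
Proof. exact: convex_derive_homo f_logconvex ln_warp_derive. Qed.

Lemma log_slope_homo : {homo u : x y / x <= y}.
Proof.
move=> x y xy; rewrite /u /log_slope -!mulrA ler_wpM2l ?ler0n//.
exact: ln_warp_slope_homo.
Qed.

Lemma pow_integrable a b :
  (@lebesgue_measure R).-integrable `[a, b] (EFin \o v).
Proof.
apply: continuous_compact_integrable; first exact: segment_compact.
exact/continuous_subspaceT/pow_continuous.
Qed.

Lemma integral_pow h :
  (\int[@lebesgue_measure R]_(t in `[0%R, h]) (v t)%:E = (mass h)%:E)%E.
Proof.
by rewrite /mass /Rintegral fineK// integrable_fin_num// pow_integrable.
Qed.

Lemma mass0 : mass 0 = 0.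
Proof. by rewrite /mass set_itv1 Rintegral_set1. Qed.

(** The interval of integration is empty for negative [h], so [mass] vanishes there and has a corner
    at 0. Hence the derivative is taken at positive points, and continuity within [[0, b]]. *)
Lemma mass_derive (h : R) : 0 < h -> is_derive h 1 mass (v h).
Proof.
move=> h0.
have hh : h < h + 1 by rewrite ltrDl.
have [] := @continuous_FTC1 R v (BLeft 0) h (h + 1) hh (pow_integrable 0 (h + 1)).
- by rewrite lte_fin.
- exact: pow_continuous.
by move=> dm e; rewrite -e derive1E; exact/derivableP.
Qed.

Lemma mass_within b : 0 <= b -> {within `[0, b], continuous mass}.
Proof.
move=> b0; exact: (@parameterized_integral_continuous _ _ _ v b0 (pow_integrable 0 b)).
Qed.

Let balance c t := v t - c * mass t.

Let balance_derive c (t : R) : 0 < t -> is_derive t 1 (balance c) (v t * (u t - c)).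
Proof.
move=> t0.
have dp := pow_derive t; have dm := mass_derive t0.
have -> : v t * (u t - c) = u t * v t - c *: v t.
  by rewrite -[_ *: _]/(_ * _); ring.
exact: (is_deriveB dp (is_deriveZ c dm)).
Qed.

Let balance_within c b : 0 <= b -> {within `[0, b], continuous (balance c)}.
Proof.
move=> b0 x; apply: continuousB; first exact/continuous_subspaceT/pow_continuous.
by apply: continuousM; [exact: cst_continuous|exact: mass_within].
Qed.

(** The derivative of [v - c * mass] is [v * (u - c)], which has the sign of [u - c]. *)
Lemma balance_le c a b : 0 <= a -> a <= b -> (forall t, a < t -> t < b -> u t <= c) ->
  v b - c * mass b <= v a - c * mass a.
Proof.
move=> a0 ab uc.
apply: (@ler0_derive1_le_cc _ (balance c) a b) => //.
- move=> t; rewrite in_itv /= => /andP[ta _].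
  by case: (balance_derive c (le_lt_trans a0 ta)).
- move=> t; rewrite in_itv /= => /andP[ta tb].
  have [_ d] := balance_derive c (le_lt_trans a0 ta).
  by rewrite derive1E d pmulr_rle0 ?pow_gt0// subr_le0 uc.
- have /continuous_subspaceW := balance_within (c := c) (le_trans a0 ab).
  by apply; apply: subset_itvr; rewrite bnd_simp.
- by rewrite in_itv/= lexx ab.
- by rewrite in_itv/= lexx ab.
Qed.

Lemma balance_ge c a b : 0 <= a -> a <= b -> (forall t, a < t -> t < b -> c <= u t) ->
  v a - c * mass a <= v b - c * mass b.
Proof.
move=> a0 ab uc.
apply: (@ger0_derive1_le_cc _ (balance c) a b) => //.
- move=> t; rewrite in_itv /= => /andP[ta _].
  by case: (balance_derive c (le_lt_trans a0 ta)).
- move=> t; rewrite in_itv /= => /andP[ta tb].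
  have [_ d] := balance_derive c (le_lt_trans a0 ta).
  by rewrite derive1E d pmulr_rge0 ?pow_gt0// subr_ge0 uc.
- have /continuous_subspaceW := balance_within (c := c) (le_trans a0 ab).
  by apply; apply: subset_itvr; rewrite bnd_simp.
- by rewrite in_itv/= lexx ab.
- by rewrite in_itv/= lexx ab.
Qed.

Lemma mass_lt a b : 0 <= a -> a < b -> mass a < mass b.
Proof.
move=> a0 ab.
have dm (x : R) : x \in `]a, b[ -> is_derive x 1 mass (v x).
  by rewrite in_itv /= => /andP[ax _]; apply: mass_derive; exact: le_lt_trans ax.
have cm : {within `[a, b], continuous mass}.
  have /continuous_subspaceW := mass_within (le_trans a0 (ltW ab)).
  by apply; apply: subset_itvr; rewrite bnd_simp.
have [c _ e] := MVT ab dm cm.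
by rewrite -subr_gt0 e mulr_gt0 ?pow_gt0// subr_gt0.
Qed.

Lemma mass_gt0 h : 0 < h -> 0 < mass h.
Proof. by move=> h0; rewrite -mass0 mass_lt. Qed.

Lemma mass_le a b : 0 <= a -> a <= b -> mass a <= mass b.
Proof.
by move=> a0; rewrite le_eqVlt => /predU1P[->//|ab]; rewrite ltW// mass_lt.
Qed.

Lemma mass_ge0 h : 0 <= h -> 0 <= mass h.
Proof. by move=> h0; rewrite -mass0 mass_le. Qed.

Lemma IfunE h : 0 < h -> Ifun n f h = v h / mass h.
Proof.
move=> h0; rewrite /Ifun derive1E.
have [_ ->] := is_derive1_comp (is_derive1_ln (mass_gt0 h0)) (mass_derive h0).
by rewrite mulrC.
Qed.

(** The derivative of [Ifun] up to a positive factor. Unlike [Ifun], it is continuous up to 0, where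
    its value is -1. *)
Let critfun h := u h * mass h - v h.

Lemma Ifun_derive (h : R) : 0 < h ->
  is_derive h 1 (Ifun n f) (critfun h * v h / mass h ^+ 2).
Proof.
move=> h0; have m0 := mass_gt0 h0; have m0' : mass h != 0 by rewrite gt_eqF.
apply: (@near_eq_is_derive _ _ _ (fun t => v t * (mass t)^-1)).
  near=> t; rewrite IfunE//; near: t; exact: lt_nbhsr.
have dV := is_deriveV m0' (mass_derive h0).
have -> : critfun h * v h / mass h ^+ 2 =
  v h *: (- mass h ^- 2 *: v h) + (mass h)^-1 *: (u h * v h).
  by rewrite -![_ *: _]/(_ * _) /critfun; field.
exact: (is_deriveM (pow_derive h) dV).
Unshelve. all: by end_near. Qed.

Lemma IcritP h : Icrit n f h <-> 0 < h /\ u h * mass h = v h.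
Proof.
split=> -[h0]; have d := Ifun_derive h0; have m0 := mass_gt0 h0.
  move=> d0; split=> //; case: d => _; case: d0 => _ -> /esym/eqP.
  rewrite mulf_eq0 invr_eq0 expf_eq0 (gt_eqF m0) andbF orbF.
  by rewrite mulf_eq0 [v h == 0]gt_eqF ?pow_gt0// orbF subr_eq0 => /eqP.
move=> e; split=> //; move: d.
by rewrite /critfun e subrr !mul0r.
Qed.

Let critfun_within b : 0 <= b -> {within `[0, b], continuous critfun}.
Proof.
move=> b0.
have cu : {within `[0, b], continuous u}.
  exact/continuous_subspaceT/log_slope_continuous.
have cv : {within `[0, b], continuous v}.
  exact/continuous_subspaceT/pow_continuous.
have cm := mass_within b0.
have -> : critfun = (u \* mass) \- v by [].
move=> x; have := continuousB (continuousM (cu x) (cm x)) (cv x).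
exact.
Qed.

Let critfun0 : critfun 0 = -1.
Proof. by rewrite /critfun mass0 mulr0 sub0r /v f_0 expr1n. Qed.

(** The infimum of the critical points is attained because the zeros of [critfun] in the closed
    half-line form a closed set, and it is positive because [critfun 0 = -1]. *)
Lemma Icrit_min h : Icrit n f h ->
  exists h0, Icrit n f h0 /\ forall h', Icrit n f h' -> h0 <= h'.
Proof.
move=> ch; pose S := [set h | Icrit n f h].
have S0 : S !=set0 by exists h.
have lS : lbound S 0 by move=> x [/ltW].
have Sinf : has_inf S by split=> //; exists 0.
pose h0 := inf S.
have h00 : 0 <= h0 by exact: lb_le_inf.
have minh0 h' : Icrit n f h' -> h0 <= h' by move=> ch'; apply: ge_inf => //; exists 0.
exists h0; split=> //.
suff cr0 : critfun h0 = 0.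
  apply/IcritP; split; last by apply/eqP; rewrite -subr_eq0; apply/eqP.
  rewrite lt_neqAle h00 andbT; apply/eqP => e; move: cr0; rewrite -e critfun0.
  by move/eqP; rewrite oppr_eq0 oner_eq0.
apply/eqP; apply/negP => /negP cr0.
have hlt : h0 < h0 + 1 by rewrite ltrDl.
have cc : {within `[h0, h0 + 1], continuous critfun}.
  have /continuous_subspaceW := critfun_within (le_trans h00 (ltW hlt)).
  by apply; apply: subset_itvr; rewrite bnd_simp.
have [_ cr _] := (continuous_within_itvP critfun hlt).1 cc.
(* If [critfun h0] were nonzero, [critfun] would not vanish just to the right of [h0], yet [S] has
   elements arbitrarily close to its infimum. *)
have [d /= d0 Hd] := cvgr_neq0 _ cr cr0.
have [s Ss sd] := inf_adherent d0 Sinf.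
have s0 := minh0 _ Ss.
have /IcritP[_ es] := Ss.
have cs0 : critfun s = 0 by rewrite /critfun es subrr.
move: s0; rewrite le_eqVlt => /predU1P[e|h0s]; first by move: cr0; rewrite e cs0 eqxx.
have := Hd s; rewrite /= cs0 eqxx => H; suff : false by [].
by apply: H => //; rewrite distrC gtr0_norm ?subr_gt0// ltrBlDl.
Qed.

Lemma omega_exists : (0 < n)%N -> unbounded_right f -> exists omega : R,
  [/\ 0 < omega, is_omega n f omega & forall h, 0 <= h -> omega * mass h <= v h].
Proof.
move=> n_gt0 f_unb.
have [[h1 ch1]|nc] := pselect (exists h, Icrit n f h).
  have [h0 [ch0 minh0]] := Icrit_min ch1.
  have /IcritP[h00 eh0] := ch0.
  have m0 := mass_gt0 h00.
  have e : Ifun n f h0 = u h0 by rewrite IfunE// -eh0 mulfK// gt_eqF.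
  exists (Ifun n f h0); split.
  - by rewrite IfunE// divr_gt0// pow_gt0.
  - by left; exists h0.
  (* The minimum of [v - u h0 * mass] is at [h0], where it is 0. *)
  - move=> h hge0; rewrite e -subr_ge0 -[X in X <= _](subrr (v h0)) -[X in _ - X <= _]eh0.
    have [hh|/ltW hh] := leP h h0.
      by apply: balance_le => // t _ /ltW; exact: log_slope_homo.
    by apply: balance_ge => // [|t /ltW ht _]; [exact: ltW|exact: log_slope_homo].
(* Starting from -1, [critfun] cannot become nonnegative without a zero, which would be a critical
   point. *)
have neg h : 0 <= h -> critfun h < 0.
  move=> h0; rewrite ltNge; apply/negP => ch.
  have [|c] := IVT (v := 0) h0 (critfun_within h0).
    rewrite critfun0 ge_min lerN10/= le_max ch orbT//.
  rewrite in_itv /= => /andP[c0 _] cc; apply: nc; exists c; apply/IcritP; split.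
    rewrite lt_neqAle c0 andbT; apply/eqP => e; move: cc; rewrite -e critfun0.
    by move/eqP; rewrite oppr_eq0 oner_eq0.
  by apply/eqP; rewrite -subr_eq0; apply/eqP.
have ub h h0 : 0 < h0 -> u h <= v h0 / mass h0.
  move=> h00; have m0 := mass_gt0 h00.
  have u0 : u h0 <= v h0 / mass h0.
    by rewrite ler_pdivlMr// -subr_le0 ltW// neg// ltW.
  have [hh|hh] := leP h h0; first exact: (le_trans (log_slope_homo hh)).
  (* Suppose [u h > v h0 / mass h0] with [h0 < h]. Then [v - u h * mass] is negative at [h0] and
     nonincreasing up to [h], whereas it is positive at [h] by [neg]. *)
  rewrite leNgt; apply/negP => uc.
  have hge0 := ltW (lt_trans h00 hh).
  have := @balance_le (u h) h0 h (ltW h00) (ltW hh).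
  have uH t : h0 < t -> t < h -> u t <= u h by move=> _ /ltW; exact: log_slope_homo.
  move=> /(_ uH); apply/negP; rewrite -ltNge.
  apply: (@lt_trans _ _ 0); first by rewrite subr_lt0 -ltr_pdivrMr.
  by rewrite subr_gt0 -subr_lt0 neg.
have hub : has_ubound (range u) by exists (v 1 / mass 1) => _ [h _ <-]; exact: ub.
(* Positivity of the supremum: [f] exceeds [f 0 = 1] somewhere, so by the mean value theorem
   [derive1 f], and with it [u], is positive at some point. *)
have [t t0 ft] := f_unb 1.
have tgt0 : 0 < t.
  rewrite lt_neqAle t0 andbT; apply/eqP => e; move: ft.
  by rewrite -e f_0 ltxx.
have [c _ ec] := MVT tgt0 (fun x _ => warp_derive x)
  (continuous_subspaceT warp_continuous).
have c0 : 0 < derive1 f c.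
  by rewrite -(@pmulr_lgt0 _ (t - 0)) ?subr_gt0// -ec f_0 subr_gt0.
exists (sup (range u)); split.
- apply: (@lt_le_trans _ _ (u c)); last by apply: ub_le_sup => //; exists c.
  by rewrite divr_gt0// mulr_gt0// ltr0n.
- right; split; first by move=> h ch; apply: nc; exists h.
  exact: nondecreasing_cvgr log_slope_homo hub.
- move=> h; rewrite le_eqVlt => /predU1P[<-|h0]; first by rewrite mass0 mulr0 ltW// pow_gt0.
  rewrite -ler_pdivlMr ?mass_gt0//; apply: ge_sup; first by exists (u 0); exists 0.
  by move=> _ [x _ <-]; exact: ub.
Qed.

(** If [derive1 f x > 0], the convex function [ln (f t)] lies above an increasing tangent line for
    [t >= x], so that [f] is unbounded. *)
Lemma bounded_warp_noninc : ~ unbounded_right f -> {homo f : x y /~ x <= y}.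
Proof.
move=> fb.
have fd0 x : derive1 f x <= 0.
  rewrite leNgt; apply/negP => fx; apply: fb => K.
  pose s := derive1 f x / f x.
  have s0 : 0 < s by rewrite divr_gt0.
  have tangent t : x <= t -> s * (t - x) <= ln (f t) - ln (f x).
    rewrite le_eqVlt => /predU1P[<-|xt]; first by rewrite !subrr mulr0.
    have cl : continuous (fun t => ln (f t)).
      move=> y; apply/differentiable_continuous/derivable1_diffP.
      by case: (ln_warp_derive y).
    have [c] := MVT xt (fun y _ => ln_warp_derive y) (continuous_subspaceT cl).
    rewrite in_itv /= => /andP[xc _] ->; rewrite ler_wpM2r ?subr_ge0 ?(ltW xt)//.
    exact/ln_warp_slope_homo/ltW.
  (* The last term is where the tangent line reaches the height [K]. There [K <= ln (f t) < f t], by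
     [1 + y <= expR y]. *)
  pose t := Num.max 0 (Num.max x (x + (K - ln (f x)) / s)).
  exists t; first by rewrite le_max lexx.
  have xt : x <= t by rewrite !le_max lexx orbT.
  have Kt : (K - ln (f x)) / s <= t - x by rewrite lerBrDl !le_max lexx !orbT.
  have := tangent t xt; move: Kt; rewrite ler_pdivrMr// mulrC => Kt.
  move=> /(le_trans Kt); rewrite lerD2r => Kl.
  rewrite (le_lt_trans Kl)// -[ltRHS]lnK ?posrE//.
  by rewrite (lt_le_trans _ (expR_ge1Dx _))// ltrDr.
move=> x y; rewrite le_eqVlt => /predU1P[->//|xy].
have [c _ e] := MVT xy (fun z _ => warp_derive z) (continuous_subspaceT warp_continuous).
by rewrite -subr_le0 e mulr_le0_ge0// subr_ge0 ltW.
Qed.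

End profile.

(** * Integrals of possibly nonmeasurable functions, and slicing *)

Section lower_integral.
Local Open Scope ereal_scope.
Context d (T : measurableType d) (R : realType) (mu : {measure set T -> \bar R}).
Import HBNNSimple.

(* The integral of a nonnegative function is a supremum over simple functions,
   so neither the integrand nor the domain needs to be measurable. *)
Lemma integral_le_simple (D : set T) (h : T -> \bar R) (M : \bar R) :
  (forall x, D x -> 0 <= h x) ->
  (forall phi : {nnsfun T >-> R}, (forall x, (phi x)%:E <= (h \_ D) x) ->
    \int[mu]_x (phi x)%:E <= M) ->
  \int[mu]_(x in D) h x <= M.
Proof.
move=> h0 hM; rewrite ge0_integralE//; apply: ge_ereal_sup => _ [phi /= ph <-].
by have := hM phi ph; rewrite integral_nnsfun// patch_setT.
Qed.

(** Every simple function below the first extension by zero is also below the second. *)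
Lemma le_integral_patch (D D' : set T) (h h' : T -> \bar R) :
  (forall x, D x -> 0 <= h x) -> (forall x, D' x -> 0 <= h' x) ->
  (forall x, (h \_ D) x <= (h' \_ D') x) ->
  \int[mu]_(x in D) h x <= \int[mu]_(x in D') h' x.
Proof.
move=> h0 h'0 hh; apply: integral_le_simple => // phi ph.
rewrite [leRHS]ge0_integralE//; apply: ereal_sup_ubound; exists phi.
  by move=> x /=; exact: le_trans (ph x) (hh x).
by rewrite integral_nnsfun// patch_setT.
Qed.

(** The measurable [psi] can be integrated off a measurable null set containing [Z]; the comparison
    with the possibly nonmeasurable [h] is then pointwise. *)
Lemma le_integral_negligible (Z D : set T) (psi h : T -> \bar R) :
  mu.-negligible Z -> measurable_fun setT psi -> (forall x, 0 <= psi x) ->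
  (forall x, D x -> 0 <= h x) -> (forall x, ~ Z x -> psi x <= (h \_ D) x) ->
  \int[mu]_x psi x <= \int[mu]_(x in D) h x.
Proof.
move=> [A [mA A0 ZA]] mpsi psi0 h0 ph.
rewrite (ge0_negligible_integral _ _ _ _ A0)//.
apply: le_integral_patch => // x.
rewrite {1}/patch; case: ifPn => [|_].
  by rewrite inE => -[_ nAx]; apply: ph => /ZA.
by rewrite /patch; case: ifPn => //; rewrite inE => /h0.
Qed.

(** One inequality holds for every positive factor, by rescaling simple functions; applied to
    [c^-1], it gives the reverse one. *)
Lemma integral_scale (D : set T) (h : T -> \bar R) (c : R) :
  (forall x, D x -> 0 <= h x) -> (0 <= c)%R ->
  \int[mu]_(x in D) (c%:E * h x) = c%:E * \int[mu]_(x in D) h x.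
Proof.
move=> h0; rewrite le_eqVlt => /predU1P[<-|c0].
  rewrite mul0e; apply: integral0_eq => x Dx; exact: mul0e.
have scale_le (k : R) (h1 : T -> \bar R) : (0 < k)%R ->
    (forall x, D x -> 0 <= h1 x) ->
    \int[mu]_(x in D) (k%:E * h1 x) <= k%:E * \int[mu]_(x in D) h1 x.
  move=> k0 h10; apply: integral_le_simple => [x Dx|phi ph].
    by rewrite mule_ge0 ?h10// lee_fin ltW.
  have k10 : (0 <= k^-1)%R by rewrite invr_ge0 ltW.
  have mphi : measurable_fun setT (EFin \o phi) by exact/measurable_EFinP.
  have phi0 x : setT x -> 0 <= (EFin \o phi) x by rewrite lee_fin.
  rewrite -lee_pdivrMl// -(ge0_integralZl_EFin _ _ phi0 mphi k10)//.
  apply: le_integral_patch => // [x _|x]; first by rewrite mule_ge0// lee_fin.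
  rewrite patch_setT lee_pdivrMl//; have := ph x; rewrite /patch.
  by case: ifP => //; rewrite mule0.
apply/eqP; rewrite eq_le scale_le//=.
have c10 : (0 < c^-1)%R by rewrite invr_gt0.
rewrite -lee_pdivlMl//.
have := scale_le c^-1%R (fun x => c%:E * h x) c10.
rewrite (eq_integral h); last first.
  by move=> x _; rewrite muleA -EFinM mulVf ?mul1e// gt_eqF.
by apply => x Dx; rewrite mule_ge0 ?h0// lee_fin ltW.
Qed.

(** A simple function below [h] on [D] can be cut along the measurable set [A]. Conversely, simple
    functions below [h] on the two pieces add up to one below [h] on [D]. *)
Lemma integral_split (D A : set T) (h : T -> \bar R) : measurable A ->
  (forall x, D x -> 0 <= h x) ->
  \int[mu]_(x in D) h x =
  \int[mu]_(x in D `&` A) h x + \int[mu]_(x in D `\` A) h x.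
Proof.
move=> mA h0.
have hA x : (D `&` A) x -> 0 <= h x by move=> [/h0].
have hB x : (D `\` A) x -> 0 <= h x by move=> [/h0].
apply/eqP; rewrite eq_le; apply/andP; split.
  apply: integral_le_simple => // phi ph.
  have mphi : measurable_fun setT (EFin \o phi) by exact/measurable_EFinP.
  rewrite -(setvU A) setUC ge0_integral_setU//; last 4 first.
  - exact: measurableC.
  - by apply: measurable_funTS.
  - by move=> x _; rewrite lee_fin.
  - exact/disj_setPCl.
  have split_le B :
      \int[mu]_(x in B) (phi x)%:E <= \int[mu]_(x in D `&` B) h x.
    apply: le_integral_patch => [x _|x [/h0]//|x].
      by rewrite lee_fin.
    rewrite {1}/patch; case: ifPn => [/set_mem Bx|_].
      have -> : (h \_ (D `&` B)) x = (h \_ D) x; last exact: ph.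
      by rewrite /patch in_setI (mem_set Bx) andbT.
    by rewrite /patch; case: ifPn => // /set_mem[/h0].
  by rewrite setDE leeD// split_le.
set M := \int[mu]_(x in D) h x.
(* The integrals are moved across the inequality by subtraction, which requires finite values. *)
have [->|Moo] := eqVneq M +oo; first by rewrite leey.
have M0 : 0 <= M by exact: integral_ge0.
have Mfin : M \is a fin_num by rewrite ge0_fin_numE// ltey.
have sub_le B : \int[mu]_(x in D `&` B) h x <= M.
  apply: le_integral_patch => // [x [/h0]//|x].
  rewrite /patch in_setI; case: ifPn => [/andP[-> _]//|_].
  by case: ifPn => // /set_mem/h0.
have subfin B : \int[mu]_(x in D `&` B) h x \is a fin_num.
  rewrite ge0_fin_numE ?(le_lt_trans (sub_le B)) ?ltey//.
  by apply: integral_ge0 => x [/h0].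
rewrite setDE -leeBrDr//; apply: integral_le_simple => // phi1 ph1.
have phi1M : \int[mu]_x (phi1 x)%:E <= \int[mu]_(x in D `&` A) h x.
  by apply: le_integral_patch => // [x _|x]; rewrite ?lee_fin// patch_setT.
have fin1 : \int[mu]_x (phi1 x)%:E \is a fin_num.
  rewrite ge0_fin_numE ?(le_lt_trans phi1M) ?ltey_eq ?subfin//.
  by apply: integral_ge0 => x _; rewrite lee_fin.
rewrite leeBrDr// -leeBrDl//; apply: integral_le_simple; first by rewrite -setDE.
move=> phi2 ph2; rewrite leeBrDl// -ge0_integralD//; last 4 first.
- by move=> x _; rewrite lee_fin.
- exact/measurable_EFinP.
- by move=> x _; rewrite lee_fin.
- exact/measurable_EFinP.
(* At each point one of [phi1] and [phi2] is at most 0, depending on membership in [A]. *)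
apply: le_integral_patch => // [x _|x]; first by rewrite -EFinD lee_fin addr_ge0.
rewrite patch_setT; have := ph1 x; have := ph2 x.
rewrite /patch !in_setI in_setC; case: (x \in D); case: (x \in A) => //= p2 p1.
- by rewrite -[leRHS]adde0 leeD.
- by rewrite -[leRHS]add0e leeD.
- by rewrite -[leRHS]add0e leeD.
- by rewrite -[leRHS]add0e leeD.
Qed.
End lower_integral.

(** * Tonelli slicing of the region under a graph *)

Section slices.
Variables (R : realType) (n : nat) (w W : R -> R).
Hypotheses (w_ge0 : forall t, 0 <= w t) (w_meas : measurable_fun [set: R] w).
Hypothesis wW : forall h : R, 0 <= h ->
  (\int[@lebesgue_measure R]_(t in `[0%R, h]) (w t)%:E = (W h)%:E)%E.
Local Notation mR := (measurableTypeR R).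
Local Notation T := (n.-tuple mR).
Implicit Types (E : set T) (a b h : T -> R) (x : n.+1.-tuple mR).
Import HBNNSimple.

Definition under_graph E h : set (n.+1.-tuple mR) :=
  [set x : n.+1.-tuple mR | E [tuple of behead x] /\ 0 <= (thead x : R) <= h [tuple of behead x]].

Let behead_cons (t : mR) (y : T) : [tuple of behead (tuple_cons (t, y))] = y.
Proof. exact: val_inj. Qed.

Lemma integral_lebesgue_cons (phi : n.+1.-tuple mR -> \bar R) :
  measurable_fun [set: _] phi -> (forall x, (0 <= phi x)%E) ->
  (measurable_fun [set: T]
     (fun y => \int[@lebesgue_measure R]_t phi (tuple_cons (t, y))) /\
   \int[lebesgue_tuple R n.+1]_x phi x =
   \int[lebesgue_tuple R n]_y \int[@lebesgue_measure R]_t phi (tuple_cons (t, y)))%E.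
Proof.
move=> mphi phi0.
have mc := @measurable_tuple_cons R n.
have mpc : measurable_fun [set: mR * T] (phi \o @tuple_cons R n).
  exact: measurableT_comp.
have pc0 z : (0 <= (phi \o @tuple_cons R n) z)%E by exact: phi0.
split; first exact: (measurable_fun_fubini_tonelli_G (phi \o @tuple_cons R n)).
rewrite -(fubini_tonelli2 (phi \o @tuple_cons R n))//.
rewrite /= /lebesgue_cons.
rewrite (ge0_integral_pushforward mc)// => y _; exact: phi0.
Qed.

(** Tonelli applies to a simple function below the integrand rather than to the integrand. Its slice
    above [y] has integral at most [W (h y) * a y], which is at most [c * b y] off [Z]. *)
Lemma under_graph_le E a b h Z (c : R) :
  (lebesgue_tuple R n).-negligible Z ->
  (forall y, 0 <= a y) -> (forall y, 0 <= b y) -> 0 <= c ->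
  (forall y, E y -> 0 <= h y) ->
  (forall y, E y -> ~ Z y -> W (h y) * a y <= c * b y) ->
  (\int[lebesgue_tuple R n.+1]_(x in under_graph E h)
     (w (thead x) * a [tuple of behead x])%:E
   <= c%:E * \int[lebesgue_tuple R n]_(y in E) (b y)%:E)%E.
Proof.
move=> Z0 a0 b0 c0 h0 Wab.
apply: integral_le_simple => [x _|phi phile]; first by rewrite lee_fin mulr_ge0.
have mphi : measurable_fun setT (EFin \o phi) by exact/measurable_EFinP.
have phi0 x : (0 <= (EFin \o phi) x)%E by rewrite lee_fin.
have [mG ->] := integral_lebesgue_cons mphi phi0.
rewrite -integral_scale//; last by move=> y _; rewrite lee_fin.
have bnd y t : ((phi (tuple_cons (t, y)))%:E <=
    if (y \in E) && (0 <= (t : R) <= h y)%R then (w t * a y)%:E else 0)%E.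
  have := phile (tuple_cons (t, y)); rewrite /patch.
  have -> : (tuple_cons (t, y) \in under_graph E h) = (y \in E) && (0 <= (t : R) <= h y).
    apply/idP/andP => [/set_mem|[/set_mem Ey th]].
      by rewrite /under_graph /= behead_cons theadE => -[/mem_set].
    by apply/mem_set; rewrite /under_graph /= behead_cons theadE.
  by rewrite behead_cons theadE; case: ifP.
apply: (le_integral_negligible Z0) => // y.
- by apply: integral_ge0 => t _; exact: phi0.
- by move=> _; rewrite -EFinM lee_fin mulr_ge0.
move=> nZ; rewrite /patch; case: ifPn => [Ey|nEy]; last first.
  rewrite le_eqVlt; apply/orP; left; apply/eqP; apply: integral0_eq => t _.
  apply/eqP; rewrite eq_le phi0 andbT (le_trans (bnd y t))//.
  by rewrite (negbTE nEy).
apply: (@le_trans _ _ (\int[@lebesgue_measure R]_(t in `[0%R, h y]) ((a y)%:E * (w t)%:E))%E).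
  apply: le_integral_patch => [t _|t _|t]; first exact: phi0.
    by rewrite -EFinM lee_fin mulr_ge0.
  rewrite patch_setT (le_trans (bnd y t))// Ey /= /patch mem_setE in_itv/=.
  by case: ifP => // _; rewrite -EFinM mulrC.
rewrite integral_scale// => [|t _]; last by rewrite lee_fin.
rewrite wW; last by apply: h0; exact: set_mem.
by rewrite -!EFinM lee_fin mulrC Wab//; exact: set_mem.
Qed.

(** A simple function [psi] below [a] on [E] is lifted to the measurable function [phi], supported
    at heights in [[0, r]]; Tonelli gives its integral. *)
Lemma under_graph_ge E a h (r : R) : (forall y, 0 <= a y) -> 0 <= r -> 0 < W r ->
  (forall y, E y -> r <= h y) ->
  ((W r)%:E * \int[lebesgue_tuple R n]_(y in E) (a y)%:E <=
   \int[lebesgue_tuple R n.+1]_(x in under_graph E h)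
     (w (thead x) * a [tuple of behead x])%:E)%E.
Proof.
move=> a0 r0 Wr0 rh.
rewrite -lee_pdivlMl//; apply: integral_le_simple => [y _|psi psile]; first by rewrite lee_fin.
rewrite lee_pdivlMl//.
pose phi (x : n.+1.-tuple mR) := ((w (thead x))%:E * (\1_`[0%R, r] (thead x))%:E *
  (psi [tuple of behead x])%:E)%E.
have phi0 x : (0 <= phi x)%E by rewrite /phi -!EFinM lee_fin !mulr_ge0.
have mth : measurable_fun [set: n.+1.-tuple mR] (@thead n mR).
  rewrite (_ : (@thead n mR) = (fun x => tnth x ord0))//; exact: measurable_tnth.
have mw : measurable_fun setT (fun x : n.+1.-tuple mR => w (thead x)).
  exact: measurableT_comp w_meas mth.
have m1 : measurable_fun setT (fun x : n.+1.-tuple mR => \1_`[0, r] (thead x) : R).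
  by apply: (measurableT_comp _ mth); exact: measurable_indic.
have mpsi : measurable_fun setT (fun x : n.+1.-tuple mR => psi [tuple of behead x]).
  apply: (measurableT_comp (measurable_funPT psi)); exact: measurable_behead.
have mphi : measurable_fun setT phi.
  have -> : phi = EFin \o (fun x => w (thead x) * \1_`[0, r] (thead x) *
      psi [tuple of behead x]) by apply/funext => x; rewrite /phi -!EFinM.
  apply/measurable_EFinP; apply: measurable_funM => //; exact: measurable_funM.
apply: (@le_trans _ _ (\int[lebesgue_tuple R n.+1]_x phi x)%E); last first.
  apply: le_integral_patch => // [x _|x]; first by rewrite lee_fin mulr_ge0.
  rewrite patch_setT /patch /phi; set y := [tuple of behead x]; set t := thead x.
  rewrite indicE mem_setE in_itv/=.
  case: ifPn => [xE|nxE].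
    rewrite -!EFinM lee_fin -mulrA ler_wpM2l//.
    have [/set_mem Ey] : y \in E /\ True by split=> //; apply/mem_set; case: (set_mem xE).
    move=> _; have := psile y; rewrite /patch (mem_set Ey) lee_fin.
    by case: (_ <= t <= _); rewrite ?mul1r ?mul0r.
  have [tr|] := boolP (0 <= (t : R) <= r); last by rewrite mule0 mul0e.
  (* A point outside the region but at height in [[0, r]] lies over the complement of [E], where
     [psi] is at most 0. *)
  have nEy : y \notin E.
    apply: contraNN nxE => /set_mem Ey; apply/mem_set; split=> //.
    by case/andP: tr => -> /= tr; exact: le_trans (rh _ Ey).
  have := psile y; rewrite /patch (negbTE nEy) mule1 => p0.
  by rewrite mule_ge0_le0// lee_fin.
have [_ ->] := integral_lebesgue_cons mphi phi0.
rewrite -ge0_integralZl_EFin//; last 3 first.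
- by move=> x _; rewrite lee_fin.
- exact/measurable_EFinP.
- exact: ltW.
apply: le_integral_patch => [y _|y _|y].
- by rewrite -EFinM lee_fin mulr_ge0// ltW.
- by apply: integral_ge0 => t _; exact: phi0.
rewrite !patch_setT -wW// muleC -integral_scale//; last by move=> t _; rewrite lee_fin.
apply: le_integral_patch => [t _|t _|t]; first by rewrite -EFinM lee_fin mulr_ge0.
  exact: phi0.
rewrite patch_setT /phi behead_cons theadE indicE /patch; case: ifPn => _ //.
  by rewrite mule1 muleC.
by rewrite mule0 mul0e.
Qed.
End slices.

(** * The Gram matrix of a graph *)

Section gram.
Variables (R : realType) (n : nat).
Implicit Types (A G : 'M[R]_n) (a : 'cV[R]_n) (v : 'rV[R]_n).

Definition posdef G := forall v, v != 0 -> 0 < (v *m G *m v^T) 0 0.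

Lemma posdef_unitmx G : posdef G -> G \in unitmx.
Proof.
move=> pG; rewrite -row_free_unit -kermx_eq0; apply/eqP/row_matrixP => i.
rewrite row0; apply/eqP; apply: contraT => v0.
have := pG _ v0; suff -> : row i (kermx G) *m G = 0 by rewrite mul0mx mxE ltxx.
by rewrite -row_mul mulmx_ker row0.
Qed.

Lemma posdefD G A (s t : R) : posdef G -> posdef A -> 0 <= s -> 0 <= t ->
  0 < s + t -> posdef (s *: G + t *: A).
Proof.
move=> pG pA s0 t0 st v v0.
rewrite mulmxDr mulmxDl -!scalemxAr -!scalemxAl !mxE.
have := pG v v0; have := pA v v0; rewrite !mxE => a0 g0.
move: s0; rewrite le_eqVlt => /predU1P[s0|s0].
  by move: st; rewrite -s0 mul0r !add0r => t1; rewrite mulr_gt0.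
by rewrite ltr_pwDl ?mulr_gt0// mulr_ge0// ltW.
Qed.

Lemma sqnorm_row_gt0 v : v != 0 -> 0 < (v *m v^T) 0 0.
Proof.
move=> v0; have [i vi] : exists i, v 0 i != 0.
  by apply/rV0Pn.
rewrite mxE (bigD1 i)//= ltr_pwDl//; first by rewrite mxE -expr2 lt0r sqr_ge0 sqrf_eq0 vi.
by apply: sumr_ge0 => j _; rewrite mxE -expr2 sqr_ge0.
Qed.

Lemma posdef_det_gt0 G : posdef G -> 0 < \det G.
Proof.
move=> pG.
have p1 : posdef 1%:M by move=> v v0; rewrite mulmx1 sqnorm_row_gt0.
(* The segment from G to the identity consists of invertible matrices. *)
pose M : 'M[{poly R}]_n := (1 - 'X) *: map_mx polyC G + 'X *: 1%:M.
have hM t : (\det M).[t] = \det ((1 - t) *: G + t *: 1%:M).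
  rewrite -horner_evalE -det_map_mx; congr (\det _); apply/matrixP => i j.
  by rewrite !mxE /= horner_evalE !hornerE hornerMn hornerC.
have nz t : 0 <= t <= 1 -> (\det M).[t] != 0.
  move=> /andP[t0 t1]; rewrite hM -unitfE -unitmxE; apply: posdef_unitmx.
  by apply: posdefD => //; rewrite ?subr_ge0// subrK ltr01.
have h0 : (\det M).[0] = \det G by rewrite hM subr0 scale1r scale0r addr0.
have h1 : (\det M).[1] = 1 by rewrite hM subrr scale1r scale0r add0r det1.
rewrite ltNge; apply/negP => G0.
(* The determinant along the segment is a polynomial equal to 1 at the identity; were it nonpositive
   at [G], it would have a root in between. *)
have [|c c01 rc] := @poly_ivt _ (\det M) 0 1 ler01.
  by rewrite h0 h1 G0 ler01.
by have := nz c c01; rewrite -rootE rc.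
Qed.

(* Both sides are the determinant of the block matrix with rows (1, -a^T) and
   (a, A). *)
Lemma det_rank1 A a : A \in unitmx ->
  \det (a *m a^T + A) = \det A * (1 + (a^T *m invmx A *m a) 0 0).
Proof.
move=> uA.
pose s := 1%:M + a^T *m invmx A *m a.
have e1 : block_mx 1%:M (- a^T) a A =
    block_mx 1%:M 0 a 1%:M *m block_mx 1%:M (- a^T) 0 (a *m a^T + A).
  rewrite mulmx_block !mul1mx !mul0mx !mulmx1 !addr0 mulmxN.
  by rewrite addrA addNr add0r.
have e2 : block_mx 1%:M (- a^T) a A =
    block_mx 1%:M (- (a^T *m invmx A)) 0 1%:M *m block_mx s 0 a A.
  rewrite mulmx_block !mul1mx !mul0mx !mulNmx !add0r mulmxKV//.
  by rewrite /s addrK.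
have := congr1 determinant e1; rewrite e2 !det_mulmx !det_ublock !det_lblock.
rewrite !det1 !mul1r => <-.
rewrite mulrC; congr (_ * _); rewrite /s.
by rewrite det_mx11 [LHS]mxE [X in X + _]mxE eqxx.
Qed.

(** By [det_rank1] it suffices that [a^T *m invmx A *m a] is nonnegative: it is the value of the
    form [A] at [a^T *m invmx A]. *)
Lemma sqrt_det_rank1 A a : A^T = A -> posdef A ->
  Num.sqrt (\det A) <= Num.sqrt (\det (a *m a^T + A)).
Proof.
move=> sA pA; have uA := posdef_unitmx pA.
rewrite det_rank1// ler_wsqrtr// ler_pMr ?posdef_det_gt0//.
rewrite lerDl.
have -> : a^T *m invmx A *m a = (a^T *m invmx A) *m A *m (a^T *m invmx A)^T.
  by rewrite mulmxKV// trmx_mul trmxK trmx_inv sA mulmxA.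
have [->|v0] := eqVneq (a^T *m invmx A) 0; first by rewrite !mul0mx mxE.
exact/ltW/pA.
Qed.
End gram.

(** * Differentials in coordinates and the Jacobian of a graph *)

Lemma near_eq_diff (R : numFieldType) (V W : normedModType R) (f g : V -> W) (x : V) :
  (\forall y \near x, f y = g y) -> differentiable f x ->
  differentiable g x /\ forall v, 'd g x v = 'd f x v.
Proof.
move=> fg df; have [dfc /eqaddoP dfo] := (diff_locallyP x f).1 df.
have fgx : f x = g x by exact: nbhs_singleton fg.
have dgo : g \o shift x = cst (g x) + 'd f x +o_ 0 id.
  apply/eqaddoP => e e0.
  have fgs : \forall h \near 0, f (h + x) = g (h + x).
    by move: fg; rewrite (near_shift 0) subr0; exact: filterS.
  move: fgs (dfo e e0); apply: filterS2 => h /= fgh.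
  by rewrite -[(_ - _) h]/(f (h + x) - (f x + 'd f x h)) fgh fgx.
have dgE := diff_unique dfc dgo.
split; last by move=> v; rewrite dgE.
by apply/diff_locallyP; rewrite dgE; split; [exact: dfc|exact: dgo].
Qed.

Lemma diff_addE (R : numFieldType) (V W : normedModType R) (f g : V -> W) (x v : V) :
  differentiable f x -> differentiable g x ->
  'd (fun y => f y + g y) x v = 'd f x v + 'd g x v.
Proof. by move=> df dg; rewrite (diffD df dg). Qed.

Lemma mulmx_differentiable (R : numFieldType) (n m : nat) (E : 'M[R]_(n, m))
  (x : 'rV[R]_n) : differentiable (fun y : 'rV[R]_n => y *m E) x.
Proof.
have -> : (fun y : 'rV[R]_n => y *m E) =
    \sum_(i < n) (fun y : 'rV[R]_n => y 0 i *: row i E).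
  by apply/funext => y; rewrite fct_sumE mulmx_sum_row.
by apply: differentiable_sum => i; apply/differentiableZl/differentiable_coord.
Qed.

Lemma mulmx_diff (R : numFieldType) (n m : nat) (E : 'M[R]_(n, m))
  (x : 'rV[R]_n) : 'd (fun y : 'rV[R]_n => y *m E) x = (fun y => y *m E) :> (_ -> _).
Proof.
have cE : continuous (mulmxr E : 'rV[R]_n -> 'rV[R]_m).
  move=> y; exact/differentiable_continuous/mulmx_differentiable.
exact: (diff_lin x cE).
Qed.

(** The map [h] stands for a graph read in charts, which has the form [row_mx (gam y)%:M y] only
    where [param] and [coord] are inverse to each other. *)
Lemma jacobian_graph (R : numFieldType) (n : nat) (gam : 'rV[R]_n -> R)
    (h : 'rV[R]_n -> 'rV[R]_(1 + n)) (x : 'rV[R]_n) :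
  differentiable gam x ->
  (\forall y \near x, row_mx (gam y)%:M y = h y) ->
  jacobian h x = row_mx (\col_i 'd gam x (delta_mx 0 i)) 1%:M.
Proof.
move=> dg gh.
pose e0 : 'rV[R]_(1 + n) := row_mx 1%:M 0.
pose E : 'M[R]_(n, 1 + n) := row_mx 0 1%:M.
have splitE (c : R) y : row_mx c%:M y = c *: e0 + y *m E.
  by rewrite /e0 /E scale_row_mx mul_mx_row scaler0 mulmx0 mulmx1 add_row_mx
    addr0 add0r scalemx1.
have d1 : differentiable (fun y => gam y *: e0) x by exact: differentiableZl.
have d2 : differentiable (fun y : 'rV[R]_n => y *m E) x by exact: mulmx_differentiable.
have hE : (fun y => row_mx (gam y)%:M y) =
    (fun y => gam y *: e0 + y *m E).
  by apply/funext => y; exact: splitE.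
have dh : differentiable (fun y => row_mx (gam y)%:M y) x.
  by rewrite hE; exact: (differentiableD d1 d2).
have [_ dhE] := near_eq_diff gh dh.
have e1 v : 'd (fun y => gam y *: e0) x v = 'd gam x v *: e0.
  by rewrite (diffZl e0 dg).
have e2 v : 'd (fun y : 'rV[R]_n => y *m E) x v = v *m E.
  by rewrite (mulmx_diff E x).
have e3 v : 'd h x v = row_mx ('d gam x v)%:M v.
  apply: (etrans (dhE v)).
  by rewrite splitE -e1 -e2 hE; exact: diff_addE.
apply/row_matrixP => i; rewrite [LHS]rowE /jacobian mul_rV_lin1 e3.
rewrite row_row_mx row1; congr row_mx.
by apply/matrixP => j k; rewrite !mxE !ord1 eqxx mulr1n.
Qed.

(** * Volumes of rooms, floors and ceilings *)

Lemma nearW_refl (V : topologicalType) (A : Type) (p : V) (c : A) :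
  \forall x \near p, c = c.
Proof. exact: filterE. Qed.

Section volumes.
Variables (R : realType) (n : nat) (f : R -> R) (N : riem_data R n).
Hypotheses (N_riem : is_riemannian N) (f_pos : forall t, 0 < f t).
Local Notation mR := (measurableTypeR R).
Local Notation T := (n.-tuple mR).
Implicit Types (F : set N) (g : N -> R) (k : nat) (q : N) (y : T).

(** The sets [fdom k] are pairwise disjoint, so the choice made by [xget] is forced. *)
Lemma first_chartE m (V : riem_data R m) k (p : V) : fdom k p -> first_chart p = k.
Proof.
move=> kp; rewrite /first_chart.
have := @xgetPex _ 0%N [set k | fdom k p] (ex_intro _ k kp).
set l := xget _ _ => lp; have [lk|kl|//] := ltngtP l k.
  by case: kp => _ /(_ _ lk); case: lp.
by case: lp => _ /(_ _ kl); case: kp.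
Qed.

(** The domain over which [volume] integrates in chart [k]. *)
Definition flat F k : set T := (@row_of_tuple R n) @^-1` (coord N k @` (F `&` @fdom _ _ N k)).

(** The volume density of [N] itself; when [f 0 = 1] it is also that of the fiber over 0. *)
Definition density k y : R := Num.sqrt (\det (gram N k (row_of_tuple y))).

Definition ceiling_density g k y : R :=
  Num.sqrt (\det (gram (induced (graph_map f g)) k (row_of_tuple y))).

Definition height g k y : R := g (param N k (row_of_tuple y)).

Lemma flatP F k y : flat F k y ->
  exists q, [/\ F q, fdom k q, dom N k q, coord N k q = row_of_tuple y &
    param N k (row_of_tuple y) = q].
Proof.
move=> [q [Fq kq] e]; exists q; have dq : dom N k q by case: kq.
by split=> //; rewrite -e riem_coordK.
Qed.

Lemma param_coord_near k q : dom N k q ->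
  \forall x \near coord N k q, coord N k (param N k x) = x.
Proof.
move=> kq; have oU : open (cdom N k) by exact: riem_cdom_open.
have Uq : cdom N k (coord N k q) by exists q.
move: (open_nbhs_nbhs (conj oU Uq)); apply: filterS => x [q' kq' <-].
by rewrite riem_coordK.
Qed.

Lemma row_of_tuple_cons (x : n.+1.-tuple mR) :
  row_of_tuple x = row_mx (thead x : R)%:M (row_of_tuple [tuple of behead x]) :> 'rV_(1 + n).
Proof.
apply/rowP => i; rewrite mxE; case: (split_ordP i) => j ->.
  rewrite row_mxEl !ord1 mxE eqxx mulr1n /thead.
  by congr tnth; apply: val_inj.
rewrite row_mxEr mxE tnth_behead; congr tnth; apply: val_inj.
by rewrite /= inordK// ltnS ltn_ord.
Qed.

Lemma det_warped_gram k (c : R) (x : 'rV[R]_n) : 0 < c ->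
  Num.sqrt (\det (c ^+ 2 *: gram N k x)) = c ^+ n * Num.sqrt (\det (gram N k x)).
Proof.
move=> c0; rewrite detZ -exprM mulnC exprM sqrtrM ?sqr_ge0// sqrtr_sqr.
by rewrite ger0_norm// exprn_ge0// ltW.
Qed.

Lemma row_mx_scalar0 (c : R) (x : 'rV[R]_n) : (row_mx c%:M x : 'rV_(1 + n)) 0 0 = c.
Proof.
have -> : 0 = lshift n (0 : 'I_1) :> 'I_(1 + n) by exact: val_inj.
by rewrite row_mxEl mxE eqxx mulr1n.
Qed.

Lemma warped_density k (t : R) (x : 'rV[R]_n) :
  Num.sqrt (\det (gram (warped f N) k (row_mx t%:M x))) =
  f t ^+ n * Num.sqrt (\det (gram N k x)).
Proof. by rewrite /= det_lblock det1 mul1r row_mx_scalar0 row_mxKr det_warped_gram. Qed.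

(** In the product chart a room is the region under the graph of [height g k], and the warped
    density is [f t ^+ n] times that of [N]. *)
Lemma room_chart F g k :
  rV_integral (coord (warped f N) k @` (room F g `&` @fdom _ _ (warped f N) k))
    (fun x => Num.sqrt (\det (gram (warped f N) k x))) =
  (\int[lebesgue_tuple R n.+1]_(x in under_graph (flat F k) (height g k))
     (f (thead x) ^+ n * density k [tuple of behead x])%:E)%E.
Proof.
rewrite /rV_integral.
have -> : @row_of_tuple R (1 + n) @^-1`
    (coord (warped f N) k @` (room F g `&` @fdom _ _ (warped f N) k)) =
    under_graph (flat F k) (height g k).
  apply/seteqP; split=> [x [[t q] [[/= Fq tg] kq]]|x [/flatP[q [Fq kq dq cq pq]] tg]].
    rewrite row_of_tuple_cons /= => /eq_row_mx[/matrixP/(_ 0 0)].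
    rewrite !mxE eqxx !mulr1n => et eq; split; first by exists q.
    by rewrite /height -eq riem_coordK//; [rewrite -et | case: kq].
  exists (thead x : R, q); last by rewrite row_of_tuple_cons /= cq.
  by split=> //; split=> //=; rewrite -pq.
apply: eq_integral => x _; congr EFin.
by rewrite row_of_tuple_cons warped_density.
Qed.

(** The column [a] consists of the partial derivatives of [g] in the chart. The last clause serves
    heights that are locally constant. *)
Lemma induced_graph g k q : fdom k q ->
  differentiable (g \o param N k) (coord N k q) ->
  exists a : 'cV[R]_n,
    gram (induced (graph_map f g)) k (coord N k q) =
      a *m a^T + f (g q) ^+ 2 *: gram N k (coord N k q) /\
    ((forall v, 'd (g \o param N k) (coord N k q) v = 0) -> a = 0).
Proof.
move=> kq dg; have dq : dom N k q by case: kq.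
exists (\col_i 'd (g \o param N k) (coord N k q) (delta_mx 0 i)); split; last first.
  by move=> d0; apply/colP => i; rewrite !mxE d0.
rewrite /= (riem_coordK N_riem dq).
rewrite (@first_chartE _ (warped f N) k (graph_map f g q)) //=.
set J := jacobian _ _.
have -> : J = row_mx (\col_i 'd (g \o param N k) (coord N k q) (delta_mx 0 i)) 1%:M.
  apply: jacobian_graph => //.
  by have := param_coord_near dq; apply: filterS => x /= ->.
rewrite row_mx_scalar0 row_mxKr mul_row_block !mulmx0 addr0 add0r mulmx1 mul1mx.
by rewrite tr_row_mx mul_row_col trmx1 mulmx1.
Qed.

Lemma ceiling_density_ge g k q y : fdom k q -> coord N k q = row_of_tuple y ->
  differentiable (g \o param N k) (coord N k q) ->
  f (g q) ^+ n * density k y <= ceiling_density g k y.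
Proof.
move=> kq e dg; have [a [ga _]] := induced_graph kq dg.
rewrite /ceiling_density /density -e ga.
have cx : cdom N k (coord N k q) by exists q => //; case: kq.
rewrite -det_warped_gram//; apply: sqrt_det_rank1.
- by rewrite linearZ /= riem_gram_sym.
- move=> v v0; rewrite -scalemxAr -scalemxAl mxE mulr_gt0 ?exprn_gt0//.
  exact: riem_gram_pos.
Qed.

Lemma ceiling_density_eq g k q y : fdom k q -> coord N k q = row_of_tuple y ->
  (\forall x \near coord N k q, g (param N k x) = g q) ->
  ceiling_density g k y = f (g q) ^+ n * density k y.
Proof.
move=> kq e gc.
have gc' : \forall x \near coord N k q, cst (g q) x = (g \o param N k) x.
  by apply: filterS gc => x /= ->.
have [dg dgE] := near_eq_diff gc' (differentiable_cst (g q) _).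
have [a [ga a0]] := induced_graph kq dg.
rewrite /ceiling_density /density -e ga a0; last first.
  by move=> v; rewrite dgE diff_cst.
by rewrite mul0mx add0r det_warped_gram.
Qed.

Hypothesis f_smooth : smooth_on [set: R] f.

Let w_ge0 (t : R) : 0 <= f t ^+ n.
Proof. by rewrite exprn_ge0// ltW. Qed.

Let w_meas : measurable_fun [set: R] (fun t => f t ^+ n).
Proof. by apply: continuous_measurable_fun; exact: pow_continuous. Qed.

Let wW h (_ : 0 <= h) :
  (\int[@lebesgue_measure R]_(t in `[0%R, h]) (f t ^+ n)%:E = (mass n f h)%:E)%E.
Proof. exact: integral_pow. Qed.

Lemma room_volumeE F g : room_volume f F g =
  (\sum_(0 <= k <oo) \int[lebesgue_tuple R n.+1]_(x in under_graph (flat F k) (height g k))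
     (f (thead x) ^+ n * density k [tuple of behead x])%:E)%E.
Proof. by apply: eq_eseriesr => k _; exact: room_chart. Qed.

Lemma floor_volumeE F : f 0 = 1 -> floor_volume f F =
  (\sum_(0 <= k <oo) \int[lebesgue_tuple R n]_(y in flat F k) (density k y)%:E)%E.
Proof.
move=> f0.
(* By conversion, the floor is the graph of the zero function. *)
transitivity (\sum_(0 <= k <oo) \int[lebesgue_tuple R n]_(y in flat F k)
    (ceiling_density (fun=> 0) k y)%:E)%E; first by [].
apply: eq_eseriesr => k _; apply: eq_integral => y /set_mem/flatP[q [_ kq _ e _]].
by rewrite (ceiling_density_eq kq e (nearW_refl (coord N k q) (0 : R))) f0 expr1n mul1r.
Qed.

Let density_ge0 k y : 0 <= density k y.
Proof. exact: sqrtr_ge0. Qed.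

Let ceiling_density_ge0 g k y : 0 <= ceiling_density g k y.
Proof. exact: sqrtr_ge0. Qed.

(** The density [b] will be that of the ceiling when [f] is unbounded, and that of the floor when
    [mass] is bounded. *)
Lemma room_volume_le F g (b : nat -> T -> R) (c : R) :
  0 <= c -> (forall k y, 0 <= b k y) -> (forall q, F q -> 0 <= g q) ->
  (forall k, exists Z, (lebesgue_tuple R n).-negligible Z /\
    forall y, flat F k y -> ~ Z y ->
      mass n f (height g k y) * density k y <= c * b k y) ->
  (room_volume f F g <=
   c%:E * \sum_(0 <= k <oo) \int[lebesgue_tuple R n]_(y in flat F k) (b k y)%:E)%E.
Proof.
move=> c0 b0 g0 mb; rewrite room_volumeE -nneseriesZl//; last first.
  by move=> k _; apply: integral_ge0 => y _; rewrite lee_fin.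
apply: lee_nneseries => [k _ _|k _].
  by apply: integral_ge0 => x _; rewrite lee_fin mulr_ge0.
have [Z [Z0 bZ]] := mb k.
apply: (under_graph_le w_ge0 wW Z0) => // y /flatP[q [Fq _ _ _ qE]].
by rewrite /height qE g0.
Qed.

Lemma room_volume_le_ceiling F g (omega : R) : 0 < omega ->
  (forall h, 0 <= h -> omega * mass n f h <= f h ^+ n) -> is_room f F g ->
  (room_volume f F g <= ceiling_volume f F g * (omega^-1)%:E)%E.
Proof.
move=> om0 omW [_ _ gd g0]; rewrite muleC.
apply: (room_volume_le (b := fun k => ceiling_density g k)) => //.
  by rewrite invr_ge0 ltW.
(* The exceptional set is formed by the coordinates of the points where [g] is not
   differentiable. *)
move=> k; exists (@row_of_tuple R n @^-1`
  (coord N k @` ([set p | F p /\ ~ differentiable_at g p] `&` dom N k))).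
split; first exact: gd.
move=> y Fy nZ; have [q [Fq kq dq e qE]] := flatP Fy.
have dg : differentiable (g \o param N k) (coord N k q).
  have [dgq|ndgq] := pselect (differentiable_at g q); first exact: dgq.
  by exfalso; apply: nZ; exists q.
have h0 : 0 <= height g k y by rewrite /height qE g0.
rewrite ler_pdivlMl// mulrA.
apply: (@le_trans _ _ (f (g q) ^+ n * density k y)).
  by rewrite ler_wpM2r//; have := omW _ h0; rewrite /height qE.
exact: ceiling_density_ge.
Qed.

Lemma room_volume_le_floor F g (c : R) : f 0 = 1 ->
  (forall h, 0 <= h -> mass n f h <= c) -> is_room f F g ->
  (room_volume f F g <= c%:E * floor_volume f F)%E.
Proof.
move=> f0 cW [_ _ gd g0]; rewrite floor_volumeE//.
apply: (room_volume_le (b := fun k => density k)) => //.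
  by apply: le_trans (cW _ (lexx 0)); rewrite mass0.
move=> k; exists set0; split; first exact: negligible_set0.
move=> y Fy _; have [q [Fq _ _ _ qE]] := flatP Fy.
by rewrite ler_wpM2r// cW// /height qE g0.
Qed.

Lemma room_volume_ge F g (r : R) : f 0 = 1 -> 0 < r ->
  (forall q, F q -> r <= g q) ->
  ((mass n f r)%:E * floor_volume f F <= room_volume f F g)%E.
Proof.
move=> f0 r0 rg; rewrite room_volumeE floor_volumeE// -nneseriesZl//; last first.
  by move=> k _; apply: integral_ge0 => y _; rewrite lee_fin.
apply: lee_nneseries => [k _ _|k _].
  rewrite mule_ge0//; first by rewrite lee_fin (mass_ge0 n f_smooth f_pos)// ltW.
  by apply: integral_ge0 => y _; rewrite lee_fin.
apply: (under_graph_ge w_ge0 w_meas wW) => //; first exact: ltW.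
  exact: mass_gt0.
by move=> y /flatP[q [Fq _ _ _ qE]]; rewrite /height qE rg.
Qed.

Lemma room_volume_sub A F g : A `<=` F -> (room_volume f A g <= room_volume f F g)%E.
Proof.
move=> AF; rewrite !room_volumeE; apply: lee_nneseries => [k _ _|k _].
  by apply: integral_ge0 => x _; rewrite lee_fin mulr_ge0.
apply: le_integral_patch => [x _|x _|x]; try by rewrite lee_fin mulr_ge0.
rewrite /patch; case: ifPn => [/set_mem[[q [Aq kq] e] h]|_].
  by rewrite ifT//; apply/mem_set; split=> //; exists q => //; split=> //; exact: AF.
by case: ifP => // _; rewrite lee_fin mulr_ge0.
Qed.

Lemma ceiling_volume_locally_const F g :
  (forall q, F q -> forall k, dom N k q ->
     \forall x \near coord N k q, g (param N k x) = g q) ->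
  ceiling_volume f F g = (\sum_(0 <= k <oo) \int[lebesgue_tuple R n]_(y in flat F k)
     (f (height g k y) ^+ n * density k y)%:E)%E.
Proof.
move=> gF; transitivity (\sum_(0 <= k <oo) \int[lebesgue_tuple R n]_(y in flat F k)
    (ceiling_density g k y)%:E)%E; first by [].
apply: eq_eseriesr => k _; apply: eq_integral => y /set_mem/flatP[q [Fq kq dq e qE]].
by rewrite (ceiling_density_eq kq e) ?/height ?qE//; exact: gF.
Qed.

Lemma ceiling_volume_const F (c : R) : f 0 = 1 ->
  ceiling_volume f F (fun=> c) = ((f c ^+ n)%:E * floor_volume f F)%E.
Proof.
move=> f0; rewrite ceiling_volume_locally_const; last by move=> q _ k _; exact: nearW_refl.
rewrite floor_volumeE// -nneseriesZl//; last first.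
  by move=> k _; apply: integral_ge0 => y _; rewrite lee_fin.
apply: eq_eseriesr => k _; rewrite -integral_scale// => y _; rewrite lee_fin//.
Qed.

Lemma locally_const_differentiable F g :
  (forall q, F q -> forall k, dom N k q ->
     \forall x \near coord N k q, g (param N k x) = g q) ->
  ae_differentiable F g.
Proof.
move=> gF k; have -> : [set p | F p /\ ~ differentiable_at g p] = set0.
  apply/seteqP; split=> // q [Fq []] l dq.
  have gc : \forall x \near coord N l q, cst (g q) x = (g \o param N l) x.
    by apply: filterS (gF q Fq l dq) => x /= ->.
  by case: (near_eq_diff gc (differentiable_cst (g q) _)).
by rewrite set0I image_set0 /rV_negligible preimage_set0; exact: negligible_set0.
Qed.

End volumes.

(** * A floor with two pieces *)

Section box.
Variable R : realType.
Local Notation mR := (measurableTypeR R).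

Definition box n (l u : 'I_n -> R) : set (n.-tuple mR) :=
  [set y | forall i, l i < tnth y i < u i].

Lemma measurable_box n (l u : 'I_n -> R) : measurable (box l u).
Proof.
have -> : box l u = \bigcap_(i in [set: 'I_n]) (fun y => tnth y i) @^-1` `]l i, u i[.
  apply/seteqP; split=> y yb i; first by move=> _; rewrite /= in_itv/= yb.
  by have := yb i I; rewrite /= in_itv.
apply: fin_bigcap_measurable => // i _.
by rewrite -[X in measurable X]setTI; apply: measurable_tnth => //; exact: measurable_itv.
Qed.

(** By induction on the dimension, splitting off the first side; for [n = 0] the measure is a Dirac
    mass at the empty tuple. *)
Lemma lebesgue_box n (l u : 'I_n -> R) : (forall i, l i < u i) ->
  (0 < lebesgue_tuple R n (box l u) < +oo)%E.
Proof.
elim: n l u => [|n IHn] l u lu.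
  rewrite /= /dirac /= indicE mem_set ?lte01 ?ltry//.
  by move=> -[].
have -> : lebesgue_tuple R n.+1 (box l u) =
    (((u ord0 - l ord0)%:E) * lebesgue_tuple R n
      (box (fun i => l (lift ord0 i)) (fun i => u (lift ord0 i))))%E.
  rewrite /= /lebesgue_cons /pushforward.
  have -> : @tuple_cons R n @^-1` box l u =
      `]l ord0, u ord0[ `*` box (fun i => l (lift ord0 i)) (fun i => u (lift ord0 i)).
    apply/seteqP; split=> [[t y] /= tb|[t y] [/=]].
      split=> [|i]; first by have := tb ord0; rewrite in_itv.
      by have := tb (lift ord0 i); rewrite /= tnthS.
    rewrite in_itv/= => tb yb i; case: (unliftP ord0 i) => [j|] ->; last exact: tb.
    by rewrite tnthS.
  rewrite product_measure1E//; last exact: measurable_box.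
  have e : (@lebesgue_measure R (`]l ord0, u ord0[%classic : set R) =
      (u ord0 - l ord0)%:E)%E.
    by rewrite lebesgue_measure_itv/= lte_fin lu EFinB.
  congr (_ * _)%E; exact: e.
have /andP[b0 boo] := IHn (fun i => l (lift ord0 i)) (fun i => u (lift ord0 i)) (fun i => lu _).
by rewrite mule_gt0 ?lte_mul_pinfty ?lee_fin ?lte_fin ?subr_gt0 ?subr_ge0// ltW.
Qed.
End box.

(** * Continuity of the determinant, smoothness of affine coordinate functions *)

Lemma continuous_big_sum (R : numFieldType) (T : topologicalType) (I : Type)
  (s : seq I) (F : I -> T -> R) (x : T) :
  (forall i, {for x, continuous (F i)}) ->
  {for x, continuous (fun y => \sum_(i <- s) F i y)}.
Proof.
move=> cF; elim: s => [|i s IHs].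
  rewrite (_ : (fun y => _) = cst 0); first exact: cst_continuous.
  by apply/funext => y; rewrite big_nil.
rewrite (_ : (fun y => _) = (fun y => F i y + \sum_(j <- s) F j y)).
  exact: (continuousD (cF i) IHs).
by apply/funext => y; rewrite big_cons.
Qed.

Lemma continuous_big_prod (R : numFieldType) (T : topologicalType) (I : Type)
  (s : seq I) (F : I -> T -> R) (x : T) :
  (forall i, {for x, continuous (F i)}) ->
  {for x, continuous (fun y => \prod_(i <- s) F i y)}.
Proof.
move=> cF; elim: s => [|i s IHs].
  rewrite (_ : (fun y => _) = cst 1); first exact: cst_continuous.
  by apply/funext => y; rewrite big_nil.
rewrite (_ : (fun y => _) = (fun y => F i y * \prod_(j <- s) F j y)).
  exact: (continuousM (cF i) IHs).
by apply/funext => y; rewrite big_cons.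
Qed.

Lemma det_continuous (R : numFieldType) (n : nat) : continuous (fun A : 'M[R]_n => \det A).
Proof.
move=> A; rewrite /determinant; apply: continuous_big_sum => s.
apply: continuousM; first exact: cst_continuous.
by apply: continuous_big_prod => i; exact: coord_continuous.
Qed.

Lemma cst_smooth (R : realType) (V : normedModType R) (U : set V) (c : R) :
  smooth_on U (cst c).
Proof.
move=> m; elim: m c => [|m IHm] c /=; first by move=> x _; exact: cst_continuous.
split=> [x _|v]; first exact: differentiable_cst.
rewrite (_ : (fun x => _) = cst 0); first exact: IHm.
by apply/funext => x; rewrite deriveE ?diff_cst//; exact: differentiable_cst.
Qed.

Lemma coord_sub_derive (R : realType) (n : nat) (i : 'I_n) (c : R) (x v : 'rV[R]_n) :
  differentiable (fun y : 'rV[R]_n => y 0 i - c) x /\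
  'D_v (fun y : 'rV[R]_n => y 0 i - c) x = v 0 i.
Proof.
split.
  have -> : (fun y : 'rV[R]_n => y 0 i - c) = (fun y : 'rV[R]_n => y 0 i) + cst (- c) by [].
  by apply: differentiableD; [exact: differentiable_coord|exact: differentiable_cst].
apply: cvg_lim => //; apply: cvg_near_cst; near=> h.
have h0 : h != 0 by near: h; exact: nbhs_dnbhs_neq.
by rewrite /= !mxE opprB addrA subrK addrK -[_ *: _]/(_ * _) mulKf.
Unshelve. all: by end_near. Qed.

Lemma coord_sub_smooth (R : realType) (n : nat) (U : set 'rV[R]_n) (i : 'I_n) (c : R) :
  smooth_on U (fun x => x 0 i - c).
Proof.
move=> [|m] /=.
  move=> x _; apply/differentiable_continuous.
  by case: (coord_sub_derive i c x 0).
split=> [x _|v]; first by case: (coord_sub_derive i c x 0).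
rewrite (_ : (fun x => _) = cst (v 0 i)); first exact: cst_smooth.
by apply/funext => x; case: (coord_sub_derive i c x v).
Qed.

(** * The slit cube in a chart and the rooms above it *)

Section split_floor.
Variables (R : realType) (n : nat) (N : riem_data R n) (k : nat).
Hypothesis N_riem : is_riemannian N.
Variables (x0 : 'rV[R]_n) (r : R) (i0 : 'I_n).
Hypothesis r_gt0 : 0 < r.
Let cube : set 'rV[R]_n := [set x | forall i, `|x 0 i - x0 0 i| <= r].
Hypothesis cube_cdom : cube `<=` cdom N k.

(* Removing the hyperplane [x 0 i0 = x0 0 i0] leaves two open boxes, so a height
   function that is constant on each of them is locally constant. *)
Let slit_cube : set 'rV[R]_n :=
  [set x | (forall i, `|x 0 i - x0 0 i| < r) /\ x 0 i0 != x0 0 i0].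

Definition split_floor : set N := [set q | dom N k q /\ slit_cube (coord N k q)].

Definition left_floor : set N := [set q | split_floor q /\ coord N k q 0 i0 < x0 0 i0].

Lemma cdom_coord x : cdom N k x -> dom N k (param N k x) /\ coord N k (param N k x) = x.
Proof. by move=> [q kq <-]; rewrite riem_coordK. Qed.

Lemma slit_cube_open : open slit_cube.
Proof.
rewrite openE => x [xr xi]; rewrite /interior.
have cx i : {for x, continuous (fun y : 'rV[R]_n => y 0 i - x0 0 i)}.
  apply: differentiable_continuous; by case: (coord_sub_derive i (x0 0 i) x 0).
have n1 : nbhs x (fun y : 'rV[R]_n => forall i, `|y 0 i - x0 0 i| < r).
  apply: (@filter_forall _ _ (fun i (y : 'rV[R]_n) => `|y 0 i - x0 0 i| < r) (nbhs x)) => i.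
  have cn : (fun y : 'rV[R]_n => `|y 0 i - x0 0 i|) @ x --> `|x 0 i - x0 0 i|.
    exact: (cvg_norm (cx i)).
  exact: (cvgr_lt _ cn).
have n2 : nbhs x (fun y : 'rV[R]_n => y 0 i0 - x0 0 i0 != 0).
  by apply: (cvgr_neq0 _ (cx i0)); rewrite subr_eq0.
by move: n1 n2; apply: filterS2 => y; rewrite subr_eq0.
Qed.

Lemma split_floor_open : open split_floor.
Proof.
rewrite openE => q [kq Dq]; rewrite /interior.
have nk : \forall p \near q, dom N k p.
  by apply: open_nbhs_nbhs; split=> //; exact: riem_dom_open.
have nD : \forall p \near q, slit_cube (coord N k p).
  apply: (riem_coord_cont N_riem kq); apply: open_nbhs_nbhs; split=> //.
  exact: slit_cube_open.
by move: nk nD; exact: filterS2.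
Qed.

Lemma cube_compact : compact cube.
Proof.
have -> : cube = [set x : 'rV[R]_n | forall i, `[x0 0 i - r, x0 0 i + r]%classic (x ord0 i)].
  apply/seteqP; split=> x xc i; have := xc i; rewrite /= in_itv/= ler_distl //.
apply: (@rV_compact _ _ (fun i => `[x0 0 i - r, x0 0 i + r]%classic)) => i.
exact: segment_compact.
Qed.

(** The image under [param] of the compact closed cube is closed, as [N] is Hausdorff, and it
    contains the floor. *)
Lemma closure_split_floor p : closure split_floor p ->
  exists x, [/\ cube x, param N k x = p, dom N k p & coord N k p = x].
Proof.
have Kc : closed (param N k @` cube).
  apply: compact_closed; first exact: riem_hausdorff.
  apply: continuous_compact cube_compact.
  apply: continuous_in_subspaceT => x /set_mem/cube_cdom; exact: riem_param_cont.
have FK : split_floor `<=` param N k @` cube.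
  by move=> q [kq [Dq _]]; exists (coord N k q); [move=> i; exact: ltW|rewrite riem_coordK].
move=> /(closure_subset FK); rewrite -(closure_id _).1// => -[x cx <-]; exists x.
by have [] := cdom_coord (cube_cdom cx).
Qed.

Lemma split_floor_piecewise_smooth : piecewise_smooth split_floor.
Proof.
have Fo : split_floor^° = split_floor by exact: (interior_id _).1 split_floor_open.
rewrite /piecewise_smooth Fo; split; first exact: subset_closure.
move=> p [cp _]; have [x [cx px kp xp]] := closure_split_floor cp.
(* A pair [(i, c)] stands for the hyperplane where coordinate [i] equals [c]: first the slit, then
   the two faces in each direction. *)
pose s : seq ('I_n * R) := (i0, x0 0 i0) ::
  [seq (i, x0 0 i - r) | i <- enum 'I_n] ++ [seq (i, x0 0 i + r) | i <- enum 'I_n].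
pose rho (j : 'I_(size s)) (x : 'rV[R]_n) := x 0 (nth (i0, 0) s j).1 - (nth (i0, 0) s j).2.
exists k, (cdom N k), (size s), rho; split=> //.
- exact: riem_cdom_open.
- by rewrite xp; exact: cube_cdom.
split; last split.
- by move=> j; exact: coord_sub_smooth.
- move=> j y _ _; exists (const_mx 1).
  have [_ ->] := coord_sub_derive (nth (i0, 0) s j).1 (nth (i0, 0) s j).2 y (const_mx 1).
  by rewrite mxE oner_neq0.
move=> y Uy [cy nFy]; have [ky ey] := cdom_coord Uy.
have [z [cz _ _ ez]] := closure_split_floor cy.
have {}cz : cube y by rewrite -ey ez.
suff [c cs c0] : exists2 c, c \in s & y 0 c.1 = c.2.
  have /(nthP (i0, 0))[j js ej] := cs.
  by exists (Ordinal js); rewrite /rho /= ej c0 subrr.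
have [e|ne] := eqVneq (y 0 i0) (x0 0 i0).
  by exists (i0, x0 0 i0); rewrite ?inE ?eqxx.
(* A point of the closed cube that is neither in the floor nor on the slit lies on a face. *)
have [i ei] : exists i, r <= `|y 0 i - x0 0 i|.
  apply: contrapT => nr; apply: nFy; split=> //; rewrite ey; split=> // i.
  by rewrite ltNge; apply/negP => ri; apply: nr; exists i.
have {}ei : `|y 0 i - x0 0 i| = r by apply/eqP; rewrite eq_le cz ei.
have [ge|lt] := leP 0 (y 0 i - x0 0 i).
  exists (i, x0 0 i + r); last by rewrite /= -ei ger0_norm// addrC subrK.
  by rewrite inE mem_cat (map_f (fun i => (i, x0 0 i + r))) ?mem_enum// !orbT.
exists (i, x0 0 i - r); last by rewrite /= -ei ltr0_norm// opprK addrC subrK.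
by rewrite inE mem_cat (map_f (fun i => (i, x0 0 i - r))) ?mem_enum// orbT.
Qed.

(* [volume] is computed at each point in the first chart containing it, so that
   only the chart [k] contributes to the volumes below. *)
Hypothesis k_first : forall l p, (l < k)%N -> ~ dom N l p.
Local Notation T := (n.-tuple (measurableTypeR R)).

Lemma fdom_first q : dom N k q -> fdom k q.
Proof. by move=> kq; split=> // l /k_first; exact. Qed.

Lemma flat_other (S : set N) l : S `<=` split_floor -> l != k -> flat S l = set0.
Proof.
move=> SF lk; apply/seteqP; split=> // y [q [/SF[kq _] [lq nq]] _].
have [lt|gt|e] := ltngtP l k; first exact: (k_first lt lq).
  exact: (nq _ gt kq).
by rewrite e eqxx in lk.
Qed.

Lemma series_flat (S : set N) (b : nat -> T -> R) : S `<=` split_floor ->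
  (forall l y, 0 <= b l y) ->
  (\sum_(0 <= l <oo) \int[lebesgue_tuple R n]_(y in flat S l) (b l y)%:E =
   \int[lebesgue_tuple R n]_(y in flat S k) (b k y)%:E)%E.
Proof.
move=> SF b0; rewrite (@nneseriesD1 _ _ k)//; last first.
  by move=> l _; apply: integral_ge0 => y _; rewrite lee_fin.
rewrite eseries0 ?adde0// => l _ /= lk.
by rewrite flat_other// integral_set0.
Qed.

Let left_box : set T :=
  box (fun i => x0 0 i - r) (fun i => if i == i0 then x0 0 i0 else x0 0 i + r).
Let right_box : set T :=
  box (fun i => if i == i0 then x0 0 i0 else x0 0 i - r) (fun i => x0 0 i + r).

Lemma flat_cdom (S : set 'rV[R]_n) (y : T) : S `<=` cdom N k ->
  flat [set q | dom N k q /\ S (coord N k q)] k y <-> S (row_of_tuple y).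
Proof.
move=> Sc; split=> [[q [[kq Sq] _] <-]//|Sy].
have [ky ey] := cdom_coord (Sc _ Sy).
by exists (param N k (row_of_tuple y)) => //; split; [split; rewrite ?ey|exact: fdom_first].
Qed.

Lemma slit_cube_cdom : slit_cube `<=` cdom N k.
Proof. by move=> x [xr _]; apply: cube_cdom => i; exact: ltW. Qed.

Lemma left_boxE (y : T) : left_box y <->
  slit_cube (row_of_tuple y) /\ row_of_tuple y 0 i0 < x0 0 i0.
Proof.
split=> [yb|[[yr _]]].
  have y0 := yb i0; rewrite eqxx in y0.
  have lt : row_of_tuple y 0 i0 < x0 0 i0 by rewrite mxE; case/andP: y0.
  split=> //; split; last by rewrite lt_eqF.
  move=> i; have := yb i; rewrite mxE ltr_distl; case: eqP => [->|_]//.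
  by move=> /andP[-> /lt_trans]; apply; rewrite ltrDl.
rewrite mxE => lt i; have := yr i; rewrite mxE ltr_distl => /andP[-> yi] /=.
by case: eqP => [->|].
Qed.

Lemma right_boxE (y : T) : right_box y <->
  slit_cube (row_of_tuple y) /\ x0 0 i0 < row_of_tuple y 0 i0.
Proof.
split=> [yb|[[yr _]]].
  have y0 := yb i0; rewrite eqxx in y0.
  have lt : x0 0 i0 < row_of_tuple y 0 i0 by rewrite mxE; case/andP: y0.
  split=> //; split; last by rewrite gt_eqF.
  move=> i; have := yb i; rewrite mxE ltr_distl; case: eqP => [->|_]//.
  move=> /andP[ix ->]; rewrite andbT (lt_trans _ ix)//.
  by rewrite ltrBlDr ltrDl.
rewrite mxE => lt i; have := yr i; rewrite mxE ltr_distl => /andP[yi ->] /=.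
by rewrite andbT; case: eqP => [->|].
Qed.

Lemma flat_left : flat left_floor k = left_box.
Proof.
pose S : set 'rV[R]_n := slit_cube `&` [set x | x 0 i0 < x0 0 i0].
have Sc : S `<=` cdom N k by move=> x [/slit_cube_cdom].
have -> : left_floor = [set q | dom N k q /\ S (coord N k q)].
  by apply/seteqP; split=> q [] => [[]|kq []].
apply/seteqP; split=> y; first by move=> /(flat_cdom _ Sc)/left_boxE.
by move=> /left_boxE ly; apply/(flat_cdom _ Sc).
Qed.

Lemma flat_splitI : flat split_floor k `&` left_box = left_box.
Proof.
by apply/setIidr => y /left_boxE[sy _]; apply/(flat_cdom _ slit_cube_cdom).
Qed.

Lemma flat_splitD : flat split_floor k `\` left_box = right_box.
Proof.
apply/seteqP; split=> y.
  move=> [/(flat_cdom _ slit_cube_cdom) sy nl].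
  apply/right_boxE; split=> //; have [_ ne] := sy.
  by move: ne; rewrite neq_lt => /orP[lt|//]; exfalso; apply/nl/left_boxE.
move=> /right_boxE[sy gt]; split; first exact/(flat_cdom _ slit_cube_cdom).
by move=> /left_boxE[_ /(lt_trans gt)]; rewrite ltxx.
Qed.

Variables (c1 c2 : R).
Hypothesis c1_gt0 : 0 < c1.
Hypothesis gram_bounds : forall x, cube x -> c1 <= Num.sqrt (\det (gram N k x)) <= c2.

(** The density lies between [c1] and [c2] on the box, whose Lebesgue measure is positive and
    finite. *)
Lemma box_volume (l u : 'I_n -> R) : (forall i, l i < u i) ->
  (forall y, box l u y -> cube (row_of_tuple y)) ->
  exists2 m, 0 < m & (\int[lebesgue_tuple R n]_(y in box l u) (density N k y)%:E = m%:E)%E.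
Proof.
move=> lu lc; have mb := measurable_box l u.
have /andP[b0 boo] := lebesgue_box lu.
set I := (\int[_]_(_ in _) _)%E.
have lb : (c1%:E * lebesgue_tuple R n (box l u) <= I)%E.
  rewrite -(integral_cst _ mb); apply: le_integral_patch => y.
  - by move=> _; rewrite lee_fin ltW.
  - by move=> _; rewrite lee_fin sqrtr_ge0.
  rewrite /patch; case: ifPn => // /set_mem/lc/gram_bounds/andP[cy _].
  by rewrite lee_fin.
have ub : (I <= c2%:E * lebesgue_tuple R n (box l u))%E.
  rewrite -(integral_cst _ mb); apply: le_integral_patch => y.
  - by move=> _; rewrite lee_fin sqrtr_ge0.
  - move=> /lc/gram_bounds/andP[cy /(le_trans cy) c12].
    by rewrite lee_fin (le_trans (ltW c1_gt0)).
  rewrite /patch; case: ifPn => // /set_mem/lc/gram_bounds/andP[_ cy].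
  by rewrite lee_fin.
have I0 : (0 < I)%E by apply: lt_le_trans lb; rewrite mule_gt0.
have Ifin : I \is a fin_num.
  rewrite ge0_fin_numE ?ltW//; apply: le_lt_trans ub _.
  have : lebesgue_tuple R n (box l u) \is a fin_num by rewrite ge0_fin_numE.
  by move=> /fineK <-; rewrite -EFinM ltry.
by exists (fine I); [rewrite fine_gt0// I0 -ge0_fin_numE// ltW|rewrite fineK].
Qed.

Definition step_height (h h' : R) (q : N) : R := if `[< left_floor q >] then h else h'.

(** Lying on a given side of the slit is an open condition on the points of [N]; continuity of
    [param N l] transfers it to an arbitrary chart. *)
Lemma step_height_locally_const h h' q l : split_floor q -> dom N l q ->
  \forall x \near coord N l q, step_height h h' (param N l x) = step_height h h' q.
Proof.
move=> Fq lq; have [kq [_ ne]] := Fq.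
have cq : {for q, continuous (fun p => coord N k p 0 i0)}.
  apply: (@continuous_comp _ _ _ (coord N k) (fun x : 'rV[R]_n => x 0 i0)).
    exact: riem_coord_cont kq.
  exact: coord_continuous.
have nF : nbhs q split_floor by apply: open_nbhs_nbhs; split; [exact: split_floor_open|].
have ng : \forall p \near q, step_height h h' p = step_height h h' q.
  rewrite /step_height; have [lt|gt|e] := ltgtP (coord N k q 0 i0) (x0 0 i0).
  - rewrite (@asboolT (left_floor q)); last by split.
    have nl : \forall p \near q, coord N k p 0 i0 < x0 0 i0 by exact: (cvgr_lt _ cq _ lt).
    apply: filterS2 nF nl => p Fp pl.
    by rewrite asboolT.
  - rewrite (@asboolF (left_floor q)); last by move=> [_ /(lt_trans gt)]; rewrite ltxx.
    have nr : \forall p \near q, x0 0 i0 < coord N k p 0 i0 by exact: (cvgr_gt _ cq _ gt).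
    apply: filterS nr => p pg.
    by rewrite asboolF// => -[_ /(lt_trans pg)]; rewrite ltxx.
  - by rewrite e eqxx in ne.
have cx : cdom N l (coord N l q) by exists q.
have ng' : nbhs (param N l (coord N l q))
    (fun p => step_height h h' p = step_height h h' q) by rewrite riem_coordK.
exact: (riem_param_cont N_riem cx ng').
Qed.

Lemma split_floor_rooms (f : R -> R) : (forall t, 0 < f t) -> f 0 = 1 ->
  exists mA mB : R, [/\ 0 < mA, 0 < mB, floor_volume f left_floor = mA%:E &
    forall h h', 0 <= h -> 0 <= h' ->
      is_room f split_floor (step_height h h') /\
      ceiling_volume f split_floor (step_height h h') =
        (f h ^+ n * mA + f h' ^+ n * mB)%:E].
Proof.
move=> f_pos f_0.
have r' (c : R) : c < c + r by rewrite ltrDl.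
have r'' (c : R) : c - r < c by rewrite ltrBlDr ltrDl.
have slitW x : slit_cube x -> cube x by move=> [xr _] i; exact: ltW.
have [|y /left_boxE[sy _]|mA mA0 mAE] := @box_volume (fun i => x0 0 i - r)
  (fun i => if i == i0 then x0 0 i0 else x0 0 i + r).
- by move=> i; case: eqP => [->//|_]; exact: lt_trans (r'' _) (r' _).
- exact: slitW.
have [|y /right_boxE[sy _]|mB mB0 mBE] := @box_volume
  (fun i => if i == i0 then x0 0 i0 else x0 0 i - r) (fun i => x0 0 i + r).
- by move=> i; case: eqP => [->//|_]; exact: lt_trans (r'' _) (r' _).
- exact: slitW.
have dens0 l y : 0 <= density N l y by exact: sqrtr_ge0.
have lF : left_floor `<=` split_floor by move=> q [].
have vol h h' : (\sum_(0 <= l <oo) \int[lebesgue_tuple R n]_(y in flat split_floor l)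
    (f (height (step_height h h') l y) ^+ n * density N l y)%:E)%E =
    (f h ^+ n * mA + f h' ^+ n * mB)%:E.
  have fd0 l y : 0 <= f (height (step_height h h') l y) ^+ n * density N l y.
    by rewrite mulr_ge0// exprn_ge0// ltW.
  rewrite (series_flat (b := fun l y => f (height (step_height h h') l y) ^+ n * density N l y))//.
  rewrite (integral_split _ (measurable_box _ _ : measurable left_box)) => [|y _]; last first.
    by rewrite lee_fin.
  rewrite flat_splitI flat_splitD EFinD !EFinM -mAE -mBE.
  rewrite -!integral_scale ?exprn_ge0 ?(ltW (f_pos _))//;
    try by move=> y _; rewrite lee_fin.
  congr (_ + _)%E; apply: eq_integral => y /set_mem.
    rewrite -flat_left => /(flatP N_riem)[q [lq _ _ _ qE]].
    by rewrite /height qE // /step_height asboolT.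
  move=> /right_boxE[sy gt]; have [ky ey] := cdom_coord (slit_cube_cdom sy).
  rewrite /height /step_height asboolF// => -[_]; rewrite ey => /(lt_trans gt).
  by rewrite ltxx.
(* As [f 0 = 1], this is [vol] with both heights 0. *)
have sF : floor_volume f split_floor = (mA + mB)%:E.
  have -> : mA + mB = f 0 ^+ n * mA + f 0 ^+ n * mB by rewrite f_0 expr1n !mul1r.
  rewrite -vol (floor_volumeE N_riem)//; apply: eq_eseriesr => l _.
  apply: eq_integral => y _; rewrite /height /step_height.
  by case: ifP => _; rewrite f_0 expr1n mul1r.
exists mA, mB; split=> //.
  by rewrite (floor_volumeE N_riem)// (series_flat (b := fun l => density N l))// flat_left.
move=> h h' h0 h'0; split; last first.
  rewrite (ceiling_volume_locally_const N_riem f_pos) ?vol// => q Fq l lq.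
  exact: step_height_locally_const.
split.
- exact: split_floor_piecewise_smooth.
- by rewrite sF ltry.
- by apply: locally_const_differentiable => q Fq l lq; exact: step_height_locally_const.
- by move=> q _; rewrite /step_height; case: ifP.
Qed.
End split_floor.

(** * Bounded warping functions *)

Lemma two_step_rooms (R : realType) (n : nat) (N : riem_data R n) (f : R -> R) (p : N) :
  (0 < n)%N -> is_riemannian N -> (forall t, 0 < f t) -> f 0 = 1 ->
  exists (F A : set N) (g : R -> R -> N -> R) (mA mB : R),
    [/\ A `<=` F, 0 < mA, 0 < mB, floor_volume f A = mA%:E &
      forall h h', 0 <= h -> 0 <= h' ->
        [/\ forall q, A q -> g h h' q = h, is_room f F (g h h') &
          ceiling_volume f F (g h h') = (f h ^+ n * mA + f h' ^+ n * mB)%:E]].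
Proof.
move=> n_gt0 N_riem f_pos f_0.
have exk : exists k, `[< exists q, dom N k q >].
  by have [k kp] := riem_cover N_riem p; exists k; apply/asboolP; exists p.
(* The first nonempty chart is chosen, so that no earlier chart meets its domain. *)
have [k /asboolP[q kq] kmin] := ex_minnP exk.
have k_first l q' : (l < k)%N -> ~ dom N l q'.
  move=> lk lq; have : (k <= l)%N by apply: kmin; apply/asboolP; exists q'.
  by rewrite leqNgt lk.
pose x0 := coord N k q.
have cx0 : cdom N k x0 by exists q.
pose d := fun x => Num.sqrt (\det (gram N k x)).
have d0 : 0 < d x0.
  rewrite sqrtr_gt0; apply: posdef_det_gt0 => v v0; exact: riem_gram_pos cx0 v0.
have cd : {for x0, continuous d}.
  apply: (@continuous_comp _ _ _ (fun x => \det (gram N k x)) Num.sqrt).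
    apply: (@continuous_comp _ _ _ (gram N k) (fun A : 'M[R]_n => \det A)).
      have gs : smooth_on (cdom N k) (gram N k) by exact: riem_gram_smooth.
      exact: (gs 0%N _ cx0).
    exact: det_continuous.
  exact: sqrt_continuous.
have near1 : nbhs x0 (fun x => d x0 / 2 <= d x).
  by apply: (cvgr_ge _ cd); rewrite ltr_pdivrMr// ltr_pMr// ltr1n.
have near2 : nbhs x0 (fun x => d x <= d x0 * 2).
  by apply: (cvgr_le _ cd); rewrite ltr_pMr// ltr1n.
have near3 : nbhs x0 (cdom N k).
  by apply: open_nbhs_nbhs; split=> //; exact: riem_cdom_open.
have near123 : nbhs x0 (cdom N k `&`
    ((fun x => d x0 / 2 <= d x) `&` (fun x => d x <= d x0 * 2))).
  by apply: filterI => //; exact: filterI.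
have /nbhs_ballP[e /= e0 eb] := near123.
(* Halving the radius puts the closed cube inside the open ball. *)
have r0 : 0 < e / 2 by rewrite divr_gt0.
have cube_ball (x : 'rV[R]_n) : (forall i, `|x 0 i - x0 0 i| <= e / 2) -> ball x0 e x.
  move=> xe; split=> // i j; rewrite !ord1 /ball /= distrC (le_lt_trans (xe j))//.
  by rewrite ltr_pdivrMr// ltr_pMr// ltr1n.
pose i0 : 'I_n := Ordinal n_gt0.
have cc (x : 'rV[R]_n) : (forall i, `|x 0 i - x0 0 i| <= e / 2) -> cdom N k x.
  by move=> /cube_ball/eb[].
have gb (x : 'rV[R]_n) : (forall i, `|x 0 i - x0 0 i| <= e / 2) -> d x0 / 2 <= d x <= d x0 * 2.
  by move=> /cube_ball/eb[_ [-> ->]].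
have d20 : 0 < d x0 / 2 by rewrite divr_gt0.
have [mA [mB [mA0 mB0 fA rooms]]] :=
  split_floor_rooms N_riem i0 r0 cc k_first d20 gb f_pos f_0.
exists (split_floor k x0 (e / 2) i0), (left_floor k x0 (e / 2) i0).
exists (step_height k x0 (e / 2) i0), mA, mB; split=> //; first by move=> q' [].
move=> h h' h0 h'0; have [room ceil] := rooms h h' h0 h'0; split=> // q' Aq.
by rewrite /step_height asboolT.
Qed.

(** For nonincreasing [f] this yields [f b ^+ n <= mass n f b / b], so a bounded mass makes [f ^+ n]
    tend to 0. *)
Lemma mass_mean (R : realType) (n : nat) (f : R -> R) (b : R) :
  smooth_on [set: R] f -> (forall t, 0 < f t) -> 0 < b ->
  exists c, [/\ 0 < c, c < b & mass n f b = f c ^+ n * b].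
Proof.
move=> f_smooth f_pos b0.
have dm (x : R) : x \in `]0, b[ -> is_derive x 1 (mass n f) (f x ^+ n).
  by rewrite in_itv /= => /andP[x0 _]; exact: mass_derive.
have [c + e] := MVT b0 dm (mass_within f_smooth f_pos (ltW b0)).
rewrite in_itv /= => /andP[c0 cb]; exists c; split=> //.
by move: e; rewrite mass0 !subr0.
Qed.

(** As [h] grows, [v h] tends to its infimum [L]. The total [c] is chosen so that in the limit
    [v h'] has to be the midpoint of [L] and [v 0 = 1], which leaves room for the correction at
    finite [h]. *)
Lemma balanced_level (R : realType) (v : R -> R) (mA mB : R) :
  continuous v -> v 0 = 1 -> (forall t, 0 <= v t) -> {homo v : x y /~ x <= y} ->
  0 < mA -> 0 < mB ->
  exists c h0, forall h, h0 <= h -> exists2 h', 0 <= h' & v h * mA + v h' * mB = c.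
Proof.
move=> cv v0 v_ge0 vle mA0 mB0.
pose S := [set v t | t in [set t | 0 <= t]].
have S0 : S !=set0 by exists (v 0); exists 0 => //=.
have lS : lbound S 0 by move=> _ [t _ <-].
have Sinf : has_inf S by split=> //; exists 0.
pose L := inf S.
have Lle t : 0 <= t -> L <= v t by move=> t0; apply: ge_inf; [exists 0|exists t].
(* If [1 <= L], then [v] is constantly 1 on the half-line and any heights will do. *)
have [L1|L1] := leP 1 L.
  have v1 t : 0 <= t -> v t = 1.
    by move=> t0; apply/eqP; rewrite eq_le (le_trans L1 (Lle t t0)) -v0 vle.
  by exists (mA + mB), 0 => h h0; exists 0; rewrite ?v1 ?mul1r.
pose m := mA / mB.
have m0 : 0 < m by rewrite divr_gt0.
(* This keeps the correction [D * m] below half the distance from the midpoint to [L]. *)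
pose e := (1 - L) / 4 / m.
have e0 : 0 < e by rewrite !divr_gt0// subr_gt0.
have [_ [h0 /= h00 <-] h0e] := inf_adherent e0 Sinf.
exists (L * mA + (1 + L) / 2 * mB), h0 => h hh.
have hge0 := le_trans h00 hh.
pose D := v h - L.
have D0 : 0 <= D by rewrite subr_ge0 Lle.
have De : D * m < (1 - L) / 4.
  by rewrite -ltr_pdivlMr// ltrBlDl (le_lt_trans (vle _ _ hh)).
have Dm0 : 0 <= D * m by rewrite mulr_ge0// ltW.
(* The value required of [v h'], obtained by solving the balance equation. *)
pose tau := (1 + L) / 2 - D * m.
have tL : L < tau by rewrite /tau; lra.
have t1 : tau <= 1 by rewrite /tau; lra.
have tL0 : 0 < tau - L by rewrite subr_gt0.
have [_ [t /= t0 <-] tt] := inf_adherent tL0 Sinf.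
rewrite -/L addrC subrK in tt.
have [|h' h't vh'] := IVT t0 (v := tau) (continuous_subspaceT cv).
  by rewrite ge_min le_max v0 t1 (ltW tt) orbT.
exists h'; first by move: h't; rewrite in_itv /= => /andP[].
rewrite vh' /tau /D /m; field.
by rewrite gt_eqF.
Qed.

Lemma bounded_not_controls (R : realType) (n : nat) (N : riem_data R n) (f : R -> R) :
  (0 < n)%N -> is_riemannian N -> smooth_on [set: R] f -> (forall t, 0 < f t) ->
  log_convex f -> f 0 = 1 -> ~ unbounded_right f -> room_volumes_unbounded f N ->
  ~ ceiling_controls_volume f N.
Proof.
move=> n_gt0 N_riem f_smooth f_pos f_lc f_0 fb rooms [Phi [_ ctrl]].
have fle := bounded_warp_noninc f_smooth f_pos f_lc fb.
pose v t := f t ^+ n.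
have vle : {homo v : x y /~ x <= y}.
  by move=> x y /fle fyx; rewrite /v lerXn2r// nnegrE ltW.
have v_gt0 t : 0 < v t by exact: exprn_gt0.
have cv : continuous v by exact: pow_continuous.
have v0 : v 0 = 1 by rewrite /v f_0 expr1n.
have m1 : 0 < mass n f 1 by exact: mass_gt0.
have [[I bI]|unb] := pselect (exists I, forall h, 0 <= h -> mass n f h <= I).
  have I0 : 0 < I by rewrite (lt_le_trans m1)// bI.
  (* A floor volume [V] above the first term gives [V^-1 <= v 1], so the height can be taken at
     least 1; above the second, [mass n f 1 * V] exceeds [Phi 1]. *)
  pose X := Num.max (v 1)^-1 ((Phi 1 + 1) / mass n f 1).
  have X0 : 0 < X by rewrite lt_max invr_gt0 v_gt0.
  have [F [g [roomFg Kvol]]] := rooms (I * X).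
  have [psF Foo _ _] := roomFg.
  have volI := room_volume_le_floor N_riem f_pos f_smooth f_0 bI roomFg.
  have {volI}XF : (X%:E < floor_volume f F)%E.
    have := lt_le_trans Kvol volI; rewrite EFinM.
    by rewrite lte_pmul2l// lte_fin.
  have Ffin : floor_volume f F \is a fin_num.
    by rewrite ge0_fin_numE// (le_trans _ (ltW XF))// lee_fin ltW.
  pose V := fine (floor_volume f F).
  have FV : floor_volume f F = V%:E by rewrite fineK.
  have XV : X < V by rewrite -lte_fin -FV.
  have V0 : 0 < V := lt_trans X0 XV.
  (* At such a [b] the mean value of [v] over [[0, b]] is at most [I / b <= V^-1], and [v b] is no
     larger. *)
  pose b := Num.max 1 (I * V).
  have b1 : 1 <= b by rewrite le_max lexx.
  have b0 : 0 < b by exact: lt_le_trans b1.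
  have vb : v b <= V^-1.
    have [c [_ cb mb]] := mass_mean n f_smooth f_pos b0.
    rewrite -(ler_pM2r b0) (le_trans (y := I))//.
      by rewrite (le_trans _ (bI b (ltW b0)))// mb ler_wpM2r ?(ltW b0)// vle// ltW.
    by rewrite ler_pdivlMl// mulrC le_max lexx orbT.
  have v1 : V^-1 <= v 1.
    rewrite -[leRHS]invrK lef_pV2 ?posrE ?invr_gt0//.
    by rewrite (le_trans _ (ltW XV))// le_max lexx.
  have [|h] := IVT b1 (v := V^-1) (continuous_subspaceT cv).
    by rewrite ge_min vb orbT le_max v1.
  rewrite in_itv /= => /andP[h1 _] vh.
  have h0 : 0 < h by exact: lt_le_trans h1.
  have roomFh : is_room f F (fun=> h).
    split=> // [|q _]; last exact: ltW.
    by apply: locally_const_differentiable => q _ k _; exact: nearW_refl.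
  have ceil : ceiling_volume f F (fun=> h) = 1%E.
    by rewrite (ceiling_volume_const N_riem)// FV -EFinM [f h ^+ n]vh mulVf// gt_eqF.
  have := ctrl F (fun=> h) roomFh; rewrite ceil => /(_ (ltry _)).
  apply/negP; rewrite -ltNge.
  apply: (lt_le_trans _ (room_volume_ge N_riem f_pos f_smooth f_0 h0 (fun _ _ => lexx h))).
  rewrite FV -EFinM lte_fin.
  have XM : (Phi 1 + 1) / mass n f 1 < V by rewrite (le_lt_trans _ XV)// le_max lexx orbT.
  apply: (@lt_le_trans _ _ (mass n f 1 * V)).
    rewrite mulrC -ltr_pdivrMr// (le_lt_trans _ XM)//.
    by rewrite ler_pM2r ?invr_gt0// lerDl.
  by rewrite ler_wpM2r ?(ltW V0)// mass_le.
have [F0 [g0 [_ room0]]] := rooms 0.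
(* If [N] were empty, every room would have volume 0. *)
have [p _] : exists p : N, True.
  apply: contrapT => np; move: room0; rewrite room_volumeE//.
  rewrite eseries0 ?ltxx// => k _ _; apply: integral0_eq => x [[q _] _].
  by exfalso; apply: np; exists q.
have [F [A [g [mA [mB [AF mA0 mB0 fA two]]]]]] :=
  two_step_rooms p n_gt0 N_riem f_pos f_0.
have [c [h0 bal]] := balanced_level cv v0 (fun t => ltW (v_gt0 t)) vle mA0 mB0.
(* From this height on, the part of the room above the first piece alone has volume larger than
   [Phi c]. *)
have [h1 [h10 mh1]] : exists h1, 0 <= h1 /\ Phi c / mA < mass n f h1.
  apply: contrapT => nh; apply: unb; exists (Phi c / mA) => h hge0.
  by rewrite leNgt; apply/negP => lt; apply: nh; exists h.
pose h := Num.max 1 (Num.max h0 h1).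
have h_gt0 : 0 < h by rewrite lt_max ltr01.
have [h' h'0 e] : exists2 h', 0 <= h' & v h * mA + v h' * mB = c.
  by apply: bal; rewrite !le_max lexx orbT.
have [gA roomF ceilF] := two h h' (ltW h_gt0) h'0.
have := ctrl F (g h h') roomF; rewrite ceilF -!/(v _) e => /(_ (ltry _)).
apply/negP; rewrite -ltNge.
apply: (lt_le_trans _ (room_volume_sub N_riem f_pos _ AF)).
have Ah q : A q -> h <= g h h' q by move=> /gA ->.
apply: (lt_le_trans _ (room_volume_ge N_riem f_pos f_smooth f_0 h_gt0 Ah)).
rewrite fA -EFinM lte_fin -ltr_pdivrMr// (lt_le_trans mh1)//.
by rewrite mass_le// !le_max lexx !orbT.
Qed.

(** * The volume criterion and the inequality for rooms *)

Unset Implicit Arguments.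

(** If a constant bounded the volumes of all rooms, a constant [Phi] would control them whatever the
    growth of [f]; hence the equivalence is stated under [room_volumes_unbounded]. *)
Theorem theorem4p1 (R : realType) (n : nat) (N : riem_data R n) (f : R -> R)
  (n_gt0 : (0 < n)%N) (N_riem : is_riemannian N)
  (f_smooth : smooth_on [set: R] f) (f_pos : forall t : R, 0 < f t)
  (f_logconvex : log_convex f) (f_0 : f 0 = 1)
  (W_complete : riem_complete (warped f N)) :
  (room_volumes_unbounded f N ->
     (ceiling_controls_volume f N <-> unbounded_right f)) /\
  (unbounded_right f ->
     ceiling_controls_volume f N /\
     exists omega : R, [/\ 0 < omega, is_omega n f omega &
       forall (F : set N) (g : N -> R), is_room f F g ->
         (room_volume f F g <= ceiling_volume f F g * (omega^-1)%:E)%E]).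
Proof.
have inequality : unbounded_right f -> exists omega : R,
    [/\ 0 < omega, is_omega n f omega & forall (F : set N) (g : N -> R),
      is_room f F g ->
      (room_volume f F g <= ceiling_volume f F g * (omega^-1)%:E)%E].
  move=> f_unb.
  have [om [om0 is_om omW]] := omega_exists f_smooth f_pos f_logconvex f_0 n_gt0 f_unb.
  by exists om; split=> // F g; exact: room_volume_le_ceiling.
have controls : unbounded_right f -> ceiling_controls_volume f N.
  move=> /inequality[om [om0 _ vol]]; exists (fun c => c / om); split.
    by move=> c c0; rewrite divr_ge0// ltW.
  move=> F g room ceil.
  have ceil0 : (0 <= ceiling_volume f F g)%E.
    by apply: nneseries_ge0 => k _ _; apply: integral_ge0 => y _; rewrite lee_fin sqrtr_ge0.
  by rewrite EFinM fineK ?vol// ge0_fin_numE.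
split=> [rooms|f_unb]; last by split; [exact: controls|exact: inequality].
split=> [ctrl|//]; apply: contrapT => fb.
exact: (bounded_not_controls n_gt0 N_riem f_smooth f_pos f_logconvex f_0 fb rooms ctrl).
Qed.
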